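(* Let $r\ge 2$, $t\ge 1$ and $s$ be integers with $tr>s\ge r$ (these inequalities force $t\ge 2$), and let $x=\left\lceil \frac{tr-s}{t-1}\right\rceil-1$. Then there exists $n_0$ (depending on $s,t,r$) such that for all $n\ge n_0$, $$\mathrm{ex}(n,K_s,tK_r)=\mathcal N\bigl(K_s,\;K_{t(r-x)-1}+T(n-t(r-x)+1,\,x)\bigr).$$
   Context: All graphs are finite and simple. A graph is $F$-free if it contains no (not necessarily induced) subgraph isomorphic to $F$. $\mathcal N(H,G)$ denotes the number of copies of $H$ in $G$, i.e. the number of (not necessarily induced) subgraphs of $G$ isomorphic to $H$. $\mathrm{ex}(n,H,F)$ is the maximum of $\mathcal N(H,G)$ over all $F$-free graphs $G$ on $n$ vertices. $K_r$ is the complete graph on $r$ vertices and $tK_r$ is the vertex-disjoint union of $t$ copies of $K_r$. For graphs $G,G'$ with disjoint vertex sets, $G+G'$ is the join: the graph on $V(G)\cup V(G')$ with edge set $E(G)\cup E(G')\cup\{uv: u\in V(G), v\in V(G')\}$. For $k\ge 1$, $T(m,k)$ is the Turán graph: the complete $k$-partite graph on $m$ vertices with each part of order $\lfloor m/k\rfloor$ or $\lceil m/k\rceil$. When $x=0$, $T(m,0)$ is interpreted as the graph with no vertices, so that the right-hand side of the claim is $\mathcal N(K_s,K_{tr-1})=\binom{tr-1}{s}$. *)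

(* Defs.v *)
From HB Require Import structures.
From mathcomp Require Import all_boot.

Set Implicit Arguments.
Unset Strict Implicit.
Unset Printing Implicit Defensive.

Section Graph.
Variable T : finType.

Record graph := Graph {
  edges : {set {set T}};
  _ : [forall e in edges, #|e| == 2]
}.

HB.instance Definition _ := [isSub for edges].
HB.instance Definition _ := [Finite of graph by <:].

Definition adj (G : graph) (u v : T) : bool := [set u; v] \in edges G.

Definition rel_edges (e : rel T) : {set {set T}} :=
  [set A : {set T} | (#|A| == 2) &&
    [exists u, exists v, e u v && (A == [set u; v])]].

Lemma rel_edges_card2 (e : rel T) : [forall A in rel_edges e, #|A| == 2].
Proof. by apply/forall_inP => A; rewrite inE => /andP[]. Qed.

(* Only used with symmetric relations [e]; loops of [e] are discarded. *)
Definition graph_of_rel (e : rel T) : graph := Graph (rel_edges_card2 e).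

End Graph.

Section Copies.
Variables U T : finType.

(* A pair [S = (A, D)] stands for the graph with vertex set [A] and edge set [D]. *)
Definition subgraph (S : {set T} * {set {set T}}) (G : graph T) : bool :=
  (S.2 \subset edges G) && [forall e in S.2, e \subset S.1].

Definition isomorphic_to (S : {set T} * {set {set T}}) (H : graph U) : bool :=
  [exists f : {ffun U -> T},
    [&& injectiveb f, f @: [set: U] == S.1 &
        [forall u, forall v, adj H u v == ([set f u; f v] \in S.2)]]].

Definition copies (H : graph U) (G : graph T) : {set {set T} * {set {set T}}} :=
  [set S | subgraph S G && isomorphic_to S H].

Definition ncopies (H : graph U) (G : graph T) : nat := #|copies H G|.

Definition is_free (F : graph U) (G : graph T) : bool := copies F G == set0.

End Copies.

(* The value is 0 if no graph on [n] vertices is [F]-free. *)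
Definition ex (n : nat) (U W : finType) (H : graph U) (F : graph W) : nat :=
  \max_(G : graph 'I_n | is_free F G) ncopies H G.

Definition complete_graph (r : nat) : graph 'I_r :=
  graph_of_rel (fun u v => u != v).

Definition disjoint_copies (t : nat) (T : finType) (G : graph T) :
    graph ('I_t * T)%type :=
  graph_of_rel (fun p q => (p.1 == q.1) && adj G p.2 q.2).

Definition join (T U : finType) (G : graph T) (H : graph U) :
    graph (T + U)%type :=
  graph_of_rel (fun a b =>
    match a, b with
    | inl u, inl v => adj G u v
    | inr u, inr v => adj H u v
    | _, _ => true
    end).

(* The [i]-th part of the balanced partition of [m] vertices into [k] parts:
   the first [m %% k] parts have one vertex more than the others. *)
Definition turan_part (m k : nat) (i : 'I_k) : nat := m %/ k + (i < m %% k).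

(* Vertices are pairs (part, position in the part), so that for [k = 0] there
   are no vertices, whatever [m] is. *)
Definition turan (m k : nat) : graph {i : 'I_k & 'I_(turan_part m i)} :=
  graph_of_rel (fun u v => tag u != tag v).
Arguments turan : clear implicits.

(* Main.v *)
(* Let r = p + x, s = a + x and q = tp - 1, so that t(p - 1) < a <= q.

   Call a clique A of order a a kernel if it is the centre of a large sunflower
   of s-cliques with petals of order x. A family of s-cliques without a large
   sunflower whose petals have at least x vertices has only O(n^(x-1)) members,
   and t petals with more than x vertices around a common clique would give
   tK_r; hence all but O(n^(x-1)) of the s-cliques contain a kernel. If the
   union Q of the kernels had tp vertices, t disjoint p-sets, each inside one
   kernel, could be found greedily and extended by petals to tK_r; so |Q| <= q.

   The common neighbourhood of a kernel becomes K_(x+1)-free after deleting O(1)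
   vertices, so by Zykov's theorem a kernel lies in at most
   (n/x)^x + O(n^(x-1)) of the s-cliques. If G has more s-cliques than the
   claimed optimum, then all a-subsets of a q-set Q must be kernels, all but
   O(1) vertices are adjacent to all of Q, and every clique of order at least r
   has at most x vertices outside Q.

   Let V1 be the common neighbourhood of Q and W the bounded set of remaining
   vertices. For u in V1, or u in W lying in an s-clique, V1 + u is
   K_(x+1)-free. Take the u with the largest (weighted) number of cliques in its
   link in V1 and replace all of W by twins of u: by the weighted Zykov theorem
   the result has at most as many s-cliques as the claimed optimum. A vertex of
   W misses a vertex of Q, hence accounts for a fraction of at most 1 - 1/q of
   what its twin contributes, and this gain of order n^(x-1) absorbs the
   O(n^(x-2)) s-cliques with two vertices in W. *)
Require Import Defs.
From mathcomp Require Import all_boot all_order all_algebra.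
From mathcomp Require Import zify.

Set Implicit Arguments.
Unset Strict Implicit.
Unset Printing Implicit Defensive.

(** * Packings of pairwise disjoint sets *)

Section Packing.
Variable V : finType.
Implicit Types (A B R S Z : {set V}) (P : pred {set V}).

Lemma subset_of_card (A B : {set V}) k : A \subset B -> #|A| <= k <= #|B| ->
  exists S : {set V}, [/\ A \subset S, S \subset B & #|S| = k].
Proof.
move=> sAB /andP[leA leB].
have [m Em] : exists m, k = #|A| + m by exists (k - #|A|); lia.
elim: m A sAB k Em leA leB => [|m IH] A sAB k Em leA leB.
  by exists A; split=> //; lia.
have : 0 < #|B :\: A| by rewrite cardsDS //; lia.
case/card_gt0P=> v; rewrite inE => /andP[vA vB].
have cA : #|v |: A| = #|A|.+1 by rewrite cardsU1 vA.
have [||||S [h1 h2 h3]] := IH (v |: A) _ k; rewrite ?cA; try lia.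
  by rewrite subUset sub1set vB.
by exists S; split=> //; apply: subset_trans h1; rewrite subsetUr.
Qed.

Lemma disjointsP A B :
  reflect (forall v, v \in A -> v \in B -> False) [disjoint A & B].
Proof.
apply: (iffP idP) => [/pred0P h v vA vB|h].
  by have := h v; rewrite /= vA vB.
by apply/pred0P=> v /=; apply/negP=> /andP[]; apply: h.
Qed.

Lemma disjointUr A B C :
  [disjoint A & B :|: C] = [disjoint A & B] && [disjoint A & C].
Proof. by rewrite -!setI_eq0 setIUr setU_eq0. Qed.

Lemma disjointUl A B C :
  [disjoint B :|: C & A] = [disjoint B & A] && [disjoint C & A].
Proof. by rewrite -!setI_eq0 setIUl setU_eq0. Qed.

(* [packing P k Z]: there are [k] pairwise disjoint sets satisfying [P], all
   disjoint from the forbidden set [Z]. *)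
Fixpoint packing P k Z : bool :=
  if k is k'.+1 then
    [exists R : {set V}, [&& P R, [disjoint R & Z] & packing P k' (R :|: Z)]]
  else true.

Lemma packingS P k Z R :
  P R -> [disjoint R & Z] -> packing P k (R :|: Z) -> packing P k.+1 Z.
Proof. by move=> h1 h2 h3 /=; apply/existsP; exists R; rewrite h1 h2. Qed.

Lemma packing_mono P P' k Z Z' : (forall R, P R -> P' R) -> Z' \subset Z ->
  packing P k Z -> packing P' k Z'.
Proof.
move=> PP'; elim: k Z Z' => [//|k IH] Z Z' sZ /existsP[R /and3P[h1 h2 h3]].
apply: packingS (PP' _ h1) _ _; first exact: disjointWr sZ h2.
by apply: IH h3; apply: setUS.
Qed.

Lemma packing_leq P k k' Z : k' <= k -> packing P k Z -> packing P k' Z.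
Proof.
elim: k k' Z => [|k IH] [|k'] Z //; rewrite ltnS => le.
by case/existsP=> R /and3P[h1 h2 h3]; apply: packingS h1 h2 _; apply: IH h3.
Qed.

Lemma packing_seqP P k Z : reflect
  (exists L : seq {set V}, [/\ size L = k, all P L,
     pairwise (fun A B : {set V} => [disjoint A & B]) L
     & all (fun A : {set V} => [disjoint A & Z]) L])
  (packing P k Z).
Proof.
apply: (iffP idP) => [|[L [<- {k}]]].
  elim: k Z => [|k IH] Z /=; first by exists [::].
  case/existsP=> R /and3P[h1 h2 /IH[L [sL aL pL dL]]].
  exists (R :: L); rewrite /= sL h1 aL pL h2 !andbT /=; split=> //.
    apply/allP=> B /(allP dL); rewrite disjoint_sym.
    by apply: disjointWl; apply: subsetUl.
  apply/allP=> B /(allP dL).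
  by apply: disjointWr; apply: subsetUr.
elim: L Z => [//|R L IH] Z /= /andP[PR aL] /andP[dR pL] /andP[RZ dL].
apply: (packingS PR RZ); apply: IH => //.
apply/allP=> B BL; rewrite disjointUr disjoint_sym (allP dR) //.
exact: (allP dL).
Qed.

(** Add disjoint members of [P] to [Z] for as long as possible: this stops before [k] of them, and
    then every member of [P] meets the collected union. *)
Lemma packing_blocking P m k Z : (forall R, P R -> #|R| <= m) ->
  ~~ packing P k Z ->
  exists Y : {set V}, [/\ #|Y| <= #|Z| + k * m, Z \subset Y &
    forall R, P R -> ~~ [disjoint R & Y]].
Proof.
move=> Pm; elim: k Z => [//|k IH] Z nP.
have [/existsP[R /andP[PR dR]]|/existsPn nR] :=
  boolP [exists R : {set V}, P R && [disjoint R & Z]].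
  have [|Y [h1 h2 h3]] := IH (R :|: Z).
    by apply: contra nP; apply: packingS.
  exists Y; split=> //; last by apply: subset_trans h2; apply: subsetUr.
  by have := Pm _ PR; have := (leq_card_setU R Z).1; lia.
exists Z; split=> //; first by rewrite leq_addr.
by move=> R PR; have := nR R; rewrite PR.
Qed.

(** Each vertex of [Z'] lies in at most one of the [k] disjoint sets, so one of them escapes. *)
Lemma packing_avoid P k Z Z' : packing P k Z -> #|Z'| < k ->
  exists B : {set V}, [/\ P B, [disjoint B & Z] & [disjoint B & Z']].
Proof.
elim: k Z Z' => [|k IH] Z Z' //= /existsP[R /and3P[h1 h2 h3]] lt.
have [dR|] := boolP [disjoint R & Z']; first by exists R.
rewrite -setI_eq0 => /set0Pn[v vi].
have [|B [b1 b2 b3]] := IH _ (Z' :\: R) h3.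
  have : #|Z' :\: R| < #|Z'|.
    apply: proper_card; rewrite properE subsetDl /=.
    apply/subsetPn; exists v; first by move: vi; rewrite inE => /andP[].
    by move: vi; rewrite !inE => /andP[->].
  lia.
move: b2; rewrite disjointUr => /andP[bR bZ]; exists B; split=> //.
rewrite -(setID Z' R) disjointUr b3 andbT.
by apply: disjointWr bR; apply: subsetIr.
Qed.

Lemma packing_cat P p k k' S Z :
  (forall R, R \subset S -> #|R| = p -> P R) ->
  #|S| = k * p -> [disjoint S & Z] ->
  packing P k' (S :|: Z) -> packing P (k + k') Z.
Proof.
elim: k S Z => [|k IH] S Z PS cS dS pk.
  by move: pk; rewrite (cards0_eq cS) set0U.
have [||R [_ RS cR]] := @subset_of_card set0 S p; rewrite ?sub0set ?cards0 //;
  first by lia.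
have dRZ: [disjoint R & Z] by apply: disjointWl dS.
apply: (packingS (PS _ RS cR) dRZ).
apply: (IH (S :\: R)).
- by move=> R' sR'; apply: PS; apply: subset_trans sR' (subsetDl _ _).
- by rewrite cardsDS //; lia.
- rewrite disjointUr; apply/andP; split; last first.
    by apply: disjointWl dS; apply: subsetDl.
  by apply/disjointsP=> v; rewrite inE => /andP[/negP].
have -> // : (S :\: R) :|: (R :|: Z) = S :|: Z.
by rewrite setUA; congr (_ :|: _); rewrite setUC -{1}(setIidPr RS) setID.
Qed.
End Packing.

(** * Packing small sets inside the members of a cover *)

Section Cover.
Variable V : finType.
Implicit Types (A B R S Z : {set V}) (P : pred {set V}).

(* Greedy: treat the last set [A] of the list first, using up its private part
   with as few [p]-sets as possible, so that nothing of the union is wasted.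
   If [A] is too small for this, then [A] and any other set suffice. *)
Lemma packing_cover P p k (L : seq {set V}) Z : 0 < p ->
  (forall A R, A \in L -> R \subset A -> #|R| = p -> P R) ->
  (forall A, A \in L -> k * p.-1 < #|A :\: Z|) ->
  k * p <= #|(\bigcup_(A <- L) A) :\: Z| ->
  packing P k Z.
Proof.
move=> p0; elim: L k Z => [|A L IH] k Z PL szL.
  rewrite big_nil set0D cards0 leqn0 muln_eq0.
  by case/orP=> /eqP E; rewrite E // in p0 *.
rewrite big_cons; set U := \bigcup_(A <- L) A => cov.
have PA R : R \subset A -> #|R| = p -> P R by apply: PL; rewrite mem_head.
have PL' A' R : A' \in L -> R \subset A' -> #|R| = p -> P R.
  by move=> A'L; apply: PL; rewrite inE A'L orbT.
have sL A' : A' \in L -> k * p.-1 < #|A' :\: Z|.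
  by move=> A'L; apply: szL; rewrite inE A'L orbT.
have split_in B S Z' k1 : (forall R, R \subset B -> #|R| = p -> P R) ->
    [disjoint S & Z'] -> S \subset B -> k1 * p <= #|S| -> packing P k1 Z'.
  move=> PB dS SB le; have [||T [_ TS cT]] := @subset_of_card _ set0 S (k1 * p).
  - exact: sub0set.
  - by rewrite cards0.
  rewrite -(addn0 k1); apply: (packing_cat (p := p) (S := T)) => //.
    by move=> R RT; apply: PB; apply: subset_trans RT (subset_trans TS SB).
  exact: disjointWl dS.
set D := A :\: Z; have szA : k * p.-1 < #|D| by apply: szL; rewrite mem_head.
set Q := D :\: U.
have dD S : S \subset D -> [disjoint S & Z].
  move=> /subsetP sS; apply/disjointsP=> v /sS.
  by rewrite inE => /andP[/negP].
have DA : D \subset A by apply: subsetDl.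
have QD : Q \subset D by apply: subsetDl.
have covE : #|(A :|: U) :\: Z| = #|Q| + #|U :\: Z|.
  rewrite -cardsUI.
  have -> : Q :&: (U :\: Z) = set0.
    by apply/setP=> v; rewrite !inE; case: (v \in U); rewrite /= ?andbF.
  rewrite cards0 addn0; congr #|pred_of_set _|; apply/setP=> v; rewrite !inE.
  by case: (v \in U); case: (v \in Z); case: (v \in A).
have [kQ|Qk] := leqP (k * p) #|Q|.
  by apply: (split_in A Q); rewrite ?dD // (subset_trans QD).
have SU A' : A' \in L -> A' \subset U.
  by move=> A'L; rewrite /U (big_rem A') //= subsetUl.
(* [m] is [#|Q| / p] rounded up, the least number of [p]-sets that can use up the private part
   [Q]. *)
pose m := (#|Q| + p.-1) %/ p.
have [mlo mhi] : #|Q| <= m * p /\ m * p <= #|Q| + p.-1.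
  have := divn_eq (#|Q| + p.-1) p; have := ltn_pmod (#|Q| + p.-1) p0.
  by rewrite /m; split; nia.
have mQ : m <= #|Q| by nia.
have mk : m <= k by nia.
(* Fill [Q] up to [m * p] vertices inside [D]: this takes fewer than [p] vertices from the union of
   the other sets, so induction applies with [k - m]. *)
have [mD|Dm] := leqP (m * p) #|D|.
  have [||S [QS SD cS]] := @subset_of_card _ Q D (m * p) => //.
    by rewrite mlo.
  rewrite -(subnKC mk); apply: (packing_cat (p := p) (S := S)) => //.
  - by move=> R RS; apply: PA; apply: subset_trans RS (subset_trans SD DA).
  - exact: dD.
  apply: IH => //.
    move=> A' A'L.
    have : #|A' :\: Z| <= #|A' :\: (S :|: Z)| + #|S :\: Q|.
      apply: leq_trans (leq_card_setU _ _).1; apply: subset_leq_card.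
      apply/subsetP=> v; rewrite !inE => /andP[vZ vA].
      have vU : v \in U by apply: (subsetP (SU _ A'L)).
      by rewrite (negPf vZ) vA vU; case: (v \in S).
    rewrite (cardsDS QS) cS; have := sL _ A'L; nia.
  have : #|(A :|: U) :\: Z| <= #|S| + #|U :\: (S :|: Z)|.
    apply: leq_trans (leq_card_setU _ _).1; apply: subset_leq_card.
    apply/subsetP=> v vin; rewrite !inE; case: (boolP (v \in S)) => //= vS.
    move: vin; rewrite !inE => /andP[vZ]; rewrite vZ /=.
    case/orP=> // vA; apply/negPn/negP=> vU; move/negP: vS; apply.
    by apply: (subsetP QS); rewrite !inE vU vZ vA.
  rewrite cS -/U; nia.
(* Otherwise [D] is too small: take [m.-1] blocks from [Q], which is disjoint from every other set,
   and all remaining ones from a single other set [A2]. *)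
have [A2 A2in] : exists A2, A2 \in L.
  case EL: L => [|A2 L']; last by exists A2; rewrite mem_head.
  by move: cov covE; rewrite /U EL big_nil setU0 set0D cards0 /D; lia.
have m0 : 0 < m by nia.
have [||S [_ SQ cS]] := @subset_of_card _ set0 Q (m.-1 * p).
- exact: sub0set.
- by rewrite cards0; nia.
have m1k : m.-1 <= k by lia.
rewrite -(subnKC m1k); apply: (packing_cat (p := p) (S := S)) => //.
- move=> R RS; apply: PA.
  exact: subset_trans RS (subset_trans SQ (subset_trans QD DA)).
- by apply: dD; apply: subset_trans SQ QD.
apply: (split_in A2 (A2 :\: Z)) => //.
- by move=> R; apply: PL'.
- apply/disjointsP=> v; rewrite !inE => /andP[/negPf vZ vA2].
  rewrite vZ orbF => /(subsetP SQ); rewrite !inE => /andP[/negP vU _].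
  by apply: vU; apply: (subsetP (SU _ A2in)).
- exact: subsetDl.
have := subset_leq_card QD; have := sL _ A2in; have := szA.
move: #|A2 :\: Z| => y.
move: #|D| #|Q| (m) Dm mlo mhi m0 m1k => d c {m mQ mk cS} m.
clear - p0.
(* For [p = 1] this case is void, since then [m = #|Q| <= #|D|]. *)
case: p p0 => [//|[|e]] _ /=; first by nia.
move=> Dm mlo mhi m0 mk szA szy cd.
case: m m0 Dm mlo mhi mk => [//|m] _ /= Dm mlo mhi mk.
have [j Ej] : exists j, k = m + j by exists (k - m); lia.
subst k; rewrite addKn.
case: j mk szA szy => [|j] mk szA szy; first by rewrite mul0n.
have : (m + j) * e >= j * e by nia.
nia.
Qed.

End Cover.

(** * Counting set families; sunflowers *)

Lemma card_bigcup_sum (I T : finType) (P : pred I) (G : I -> {set T}) :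
  #|\bigcup_(i | P i) G i| <= \sum_(i | P i) #|G i|.
Proof.
elim/big_rec2: _ => [|i m B _ IH]; first by rewrite cards0.
by apply: leq_trans (leq_card_setU _ _).1 _; rewrite leq_add2l.
Qed.

Lemma card_bigcup_le (I T : finType) (P : pred I) (G : I -> {set T}) d :
  (forall i, P i -> #|G i| <= d) ->
  #|\bigcup_(i | P i) G i| <= #|[set i | P i]| * d.
Proof.
move=> le; apply: leq_trans (card_bigcup_sum _ _) _.
by rewrite -sum1dep_card big_distrl /=; apply: leq_sum => i /le; rewrite mul1n.
Qed.

Section Counting.
Variable V : finType.
Implicit Types (A B E K R S Y Z : {set V}) (H : {set {set V}}).

(** A nonempty set is a vertex added to a smaller set; the choice [None] accounts for the empty set,
    whence the base [#|V|.+1]. *)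
Lemma card_small_sets m : #|[set B : {set V} | #|B| <= m]| <= #|V|.+1 ^ m.
Proof.
elim: m => [|m IH].
  rewrite expn0 -(cards1 (@set0 V)) subset_leq_card //.
  by apply/subsetP=> B; rewrite !inE leqn0 cards_eq0.
pose f (p : option V * {set V}) :=
  if p.1 is Some v then v |: p.2 else p.2.
have sub : [set B : {set V} | #|B| <= m.+1] \subset
   f @: setX [set: option V] [set B : {set V} | #|B| <= m].
  apply/subsetP=> B; rewrite inE => leB; apply/imsetP.
  have [->|[v vB]] := set_0Vmem B.
    by exists (None, set0); rewrite // !inE /= cards0.
  exists (Some v, B :\ v); last by rewrite /f /= setD1K.
  by rewrite !inE /=; have := cardsD1 v B; rewrite vB; lia.
apply: leq_trans (subset_leq_card sub) _.
apply: leq_trans (leq_imset_card _ _) _.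
rewrite cardsX cardsT card_option expnS; exact: leq_mul.
Qed.

Lemma card_supersets H K m : #|K| <= m ->
  (forall E, E \in H -> K \subset E /\ #|E| <= m) ->
  #|H| <= #|V|.+1 ^ (m - #|K|).
Proof.
move=> Km HK; apply: leq_trans (card_small_sets _).
have inj : {in H &, injective (fun E => E :\: K)}.
  move=> E E' EH E'H eqE; have [KE _] := HK _ EH; have [KE' _] := HK _ E'H.
  by rewrite -(setID E K) -(setID E' K) eqE (setIidPr KE) (setIidPr KE').
rewrite -(card_in_imset inj).
apply: subset_leq_card; apply/subsetP=> _ /imsetP[E EH ->]; rewrite inE.
by have [KE le] := HK _ EH; rewrite cardsDS //; lia.
Qed.

Lemma card_meeting H Y m d : (forall E, E \in H -> ~~ [disjoint E & Y]) ->
  (forall v, v \in Y -> #|[set E in H | v \in E]| <= d) ->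
  #|Y| <= m -> #|H| <= m * d.
Proof.
move=> meet le leY.
apply: (@leq_trans #|\bigcup_(v in Y) [set E in H | v \in E]|).
  apply: subset_leq_card; apply/subsetP=> E EH.
  have := meet _ EH; rewrite -setI_eq0 => /set0Pn[v].
  by rewrite inE => /andP[vE vY]; apply/bigcupP; exists v; rewrite // inE EH.
apply: (@leq_trans (\sum_(v in Y) #|[set E in H | v \in E]|)).
  exact: card_bigcup_sum.
apply: (@leq_trans (\sum_(v in Y) d)); first exact: leq_sum.
by rewrite sum_nat_const leq_mul2r leY orbT.
Qed.

(** Group the sets by their trace [B] on [D']; within a group a set is determined by its trace on
    [R], a subset of [Q'] of order [k B]. *)
Lemma card_fiber_draws (H : {set {set V}}) (D' R Q' : {set V}) (PB : pred {set
  V}) k :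
  (forall E, E \in H ->
     [/\ PB (E :&: D'), E :&: R \subset Q' & #|E :&: R| = k (E :&: D')]) ->
  {in H &, forall E E', E :&: D' = E' :&: D' -> E :&: R = E' :&: R -> E = E'} ->
  #|H| <= \sum_(B : {set V} | PB B) 'C(#|Q'|, k B).
Proof.
move=> HP inj; apply: (@leq_trans
    (\sum_(B : {set V} | PB B) #|[set E : {set V} in H | E :&: D' == B]|)).
  apply: (@leq_trans #|\bigcup_(B : {set V} | PB B) [set E : {set V} in H | E
    :&: D' == B]|).
    apply: subset_leq_card; apply/subsetP=> E EH; have [PE _ _] := HP _ EH.
    by apply/bigcupP; exists (E :&: D'); rewrite // inE EH eqxx.
  exact: card_bigcup_sum.
apply: leq_sum => B _; rewrite -cards_draws.
have injR : {in [set E : {set V} in H | E :&: D' == B] &,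
  injective (fun E : {set V} => E :&: R)}.
  move=> E E'; rewrite !inE => /andP[EH /eqP EB] /andP[E'H /eqP EB'].
  by apply: inj => //; rewrite EB EB'.
rewrite -(card_in_imset injR); apply: subset_leq_card.
apply/subsetP=> _ /imsetP[E + ->]; rewrite !inE => /andP[EH /eqP EB].
by have [_ -> ->] := HP _ EH; rewrite EB eqxx.
Qed.

(* If the petals of every sunflower with [M] petals in the [s]-uniform [H] are
   smaller than [p], then branching [s - p + 1] times over a bounded blocking
   set of the link shows that [H] has the size of a family of [p - 1]-sets. *)
Lemma card_sunflower_free H s p M : 0 < p <= s ->
  (forall E, E \in H -> #|E| = s) ->
  (forall K, #|K| <= s - p -> ~~ packing (fun B => K :|: B \in H) M K) ->
  #|H| <= (M * s + s) ^ (s - p).+1 * #|V|.+1 ^ p.-1.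
Proof.
move=> /andP[p0 ps] Hs nH.
(* [d] counts the branchings that remain; at [d = 0] only [p.-1] vertices outside [K] are left to
   choose. *)
suff main d K : #|K| + d = (s - p).+1 ->
    #|[set E in H | K \subset E]| <= (M * s + s) ^ d * #|V|.+1 ^ p.-1.
  have := main (s - p).+1 set0; rewrite cards0 => /(_ erefl).
  apply: leq_trans; apply: subset_leq_card; apply/subsetP=> E EH.
  by rewrite inE EH sub0set.
elim: d K => [|d IH] K cK.
  rewrite mul1n; have -> : p.-1 = s - #|K| by lia.
  apply: card_supersets => [|E]; first by lia.
  by rewrite inE => /andP[/Hs -> ->].
have nK : ~~ packing (fun B => (K :|: B \in H) && (#|B| <= s)) M K.
  apply: contra (nH K _); last by lia.
  by apply: packing_mono => // R /andP[].
have [|Y [cY KY meetY]] := packing_blocking (m := s) _ nK.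
  by move=> R /andP[].
have -> : (M * s + s) ^ d.+1 * #|V|.+1 ^ p.-1 =
  (M * s + s) * ((M * s + s) ^ d * #|V|.+1 ^ p.-1) by rewrite expnS mulnA.
apply: (@card_meeting _ (Y :\: K)).
- move=> E; rewrite inE => /andP[EH KE].
  have := meetY (E :\: K).
  have -> : K :|: E :\: K = E by rewrite -{1}(setIidPr KE) setID.
  rewrite EH /=.
  have -> : #|E :\: K| <= s.
    by rewrite -(Hs _ EH) subset_leq_card // subsetDl.
  move=> /(_ isT); apply: contra => /disjointsP h; apply/disjointsP => v.
  by rewrite inE => /andP[vK vE] vY; apply: (h v) => //; rewrite inE vK.
- move=> v; rewrite inE => /andP[vK vY].
  have -> : [set E in [set E in H | K \subset E] | v \in E] =
            [set E in H | v |: K \subset E].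
    by apply/setP=> E; rewrite !inE subUset sub1set -andbA (andbC (v \in E)).
  by apply: IH; rewrite cardsU1 vK; lia.
have := subset_leq_card (subsetDl Y K); lia.
Qed.
End Counting.

(** * Cliques, and disjoint cliques obtained from sunflowers *)

Section Cliques.
Variables (V : finType) (e : rel V).
Hypothesis e_sym : symmetric e.
Implicit Types (A B E K R S Y Z : {set V}) (F : {set {set V}}).

Definition clique B := [forall u in B, forall v in B, (u != v) ==> e u v].

Lemma cliqueP B :
  reflect {in B &, forall u v, u != v -> e u v} (clique B).
Proof.
apply: (iffP forall_inP) => h u => [v uB vB neq|uB].
  by move/forall_inP: (h _ uB) => /(_ v vB) /implyP; apply.
by apply/forall_inP=> v vB; apply/implyP; apply: h.
Qed.

Lemma cliqueS A B : A \subset B -> clique B -> clique A.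
Proof.
move=> /subsetP sAB /cliqueP h; apply/cliqueP=> u v /sAB uB /sAB vB.
exact: h.
Qed.

Lemma cliqueU A B : clique A -> clique B ->
  (forall u v, u \in A -> v \in B -> u != v -> e u v) -> clique (A :|: B).
Proof.
move=> /cliqueP hA /cliqueP hB h; apply/cliqueP=> u v; rewrite !inE.
case/orP=> hu /orP[] hv neq; first exact: hA; first exact: h; last exact: hB.
by rewrite e_sym; apply: h; rewrite // eq_sym.
Qed.

Definition kclique r B := clique B && (#|B| == r).

(** Each petal is completed to an [r]-clique by [r - p] vertices of the centre [K], different ones
    for different petals. If [r < p], the truncated difference is 0 and part of the petal
    suffices. *)
Lemma packing_sunflower r p k K : k * (r - p) <= #|K| ->
  packing (fun B => (#|B| == p) && clique (K :|: B)) k K ->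
  packing (kclique r) k set0.
Proof.
suff main Z Z' K' : K' \subset K -> K \subset Z ->
    Z' \subset Z -> [disjoint K' & Z'] -> k * (r - p) <= #|K'| ->
    packing (fun B => (#|B| == p) && clique (K :|: B)) k Z ->
    packing (kclique r) k Z'.
  move=> le pk; apply: (main K set0 K) => //; first exact: sub0set.
  by rewrite -setI_eq0 setI0.
elim: k Z Z' K' => [//|k IH] Z Z' K' sK'K sKZ sZ' dK' le /=.
case/existsP=> B /and3P[/andP[/eqP cB clB] dB pk].
have [||J [_ JK' cJ]] := @subset_of_card _ set0 K' (r - p).
- exact: sub0set.
- by rewrite cards0 /=; apply: leq_trans le; rewrite mulSn leq_addr.
have dBJ : [disjoint B & J].
  by apply: disjointWr dB; apply: subset_trans JK' (subset_trans sK'K sKZ).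
have cBJ : #|B :|: J| = p + (r - p)
  by rewrite cardsU (disjoint_setI0 dBJ) cards0; lia.
have [||R [_ RBJ cR]] := @subset_of_card _ set0 (B :|: J) r.
- exact: sub0set.
- by rewrite cards0 cBJ; lia.
have JK : J \subset K by apply: subset_trans JK' sK'K.
apply: (packingS (R := R)).
- rewrite /kclique cR eqxx andbT; apply: cliqueS clB.
  by apply: subset_trans RBJ _; rewrite setUC; apply: setSU.
- apply: disjointWl RBJ _; rewrite disjointUl; apply/andP; split.
    exact: disjointWr dB.
  exact: disjointWl dK'.
apply: (IH (B :|: Z) _ (K' :\: J)) => //.
- by apply: subset_trans sK'K; apply: subsetDl.
- by apply: subset_trans sKZ _; apply: subsetUr.
- rewrite subUset (subset_trans RBJ) /=; last first.
    by apply: setUS; apply: subset_trans JK sKZ.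
  by apply: subset_trans sZ' _; apply: subsetUr.
- rewrite disjointUr; apply/andP; split; last first.
    by apply: disjointWl dK'; apply: subsetDl.
  apply/disjointsP=> v; rewrite inE => /andP[/negPf vJ vK'] /(subsetP RBJ).
  rewrite inE vJ orbF => vB; move/disjointsP: dB => /(_ v vB); apply.
  by apply: (subsetP sKZ); apply: (subsetP sK'K).
by rewrite cardsDS // cJ; move: le; rewrite mulSn; lia.
Qed.

(** Each [p]-set lies in some [A] of [F] and takes one of the [M] petals of [A]. At most
    [#|Z| + k * r < M] vertices have to be avoided, so a suitable petal exists at every stage. *)
Lemma packing_extend F r p x M k Z : r = p + x ->
  (forall A, A \in F ->
     packing (fun B => (#|B| == x) && clique (A :|: B)) M A) ->
  #|Z| + k * r < M ->
  packing (fun R => (#|R| == p) && [exists A in F, R \subset A]) k Z ->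
  packing (kclique r) k Z.
Proof.
move=> Er HF lt /packing_seqP[L [sL]]; elim: L k Z sL lt => [|R L IH] k Z /=.
  by move=> <-.
move=> <- lt /andP[/andP[/eqP cR /exists_inP[A AF RA]] aL] /andP[dR pL].
case/andP=> RZ dL.
(* The petal must also miss the [p]-sets that are yet to be extended. *)
pose U := \bigcup_(B <- L) B.
have cU : #|U| <= size L * p.
  rewrite /U; elim: (L) aL => [|B L' IHL] /=; first by rewrite big_nil cards0.
  case/andP=> /andP[/eqP cB _] /IHL h; rewrite big_cons.
  by have := (leq_card_setU B (\bigcup_(B <- L') B)).1; rewrite cB; lia.
have [|B [/andP[/eqP cB clB] dB]] :=
    @packing_avoid _ _ _ _ (Z :|: R :|: U) (HF _ AF).
  have := (leq_card_setU (Z :|: R) U).1.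
  have := (leq_card_setU Z R).1; rewrite cR; nia.
rewrite !disjointUr => /andP[/andP[BZ BR] BU].
apply: (packingS (R := R :|: B)).
- rewrite /kclique (cliqueS _ clB) /=; last exact: setSU.
  by rewrite cardsU setIC (disjoint_setI0 BR) cards0 cR cB Er subn0.
- by rewrite disjointUl RZ.
apply: IH => //.
  have := (leq_card_setU (R :|: B) Z).1.
  by have := (leq_card_setU R B).1; rewrite cR cB; lia.
apply/allP=> C CL; rewrite !disjointUr (allP dL) // andbT disjoint_sym.
rewrite (allP dR) //= disjoint_sym; apply: disjointWr BU.
by rewrite /U (big_rem C) //= subsetUl.
Qed.
End Cliques.

(** * Multilinear clique polynomials *)

Section Multilinear.
Variable V : finType.
Implicit Types (B : {set V}) (f : {set V} -> nat) (y z : V -> nat) (u v : V).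

Lemma big_setU1_split u f :
  \sum_B f B = \sum_(B : {set V} | u \notin B) (f B + f (u |: B)).
Proof.
rewrite (bigID (fun B : {set V} => u \notin B)) /= big_split /=; congr (_ + _).
rewrite (reindex_onto (fun B => u |: B) (fun B => B :\ u)) /=; last first.
  by move=> B; rewrite negbK; apply: setD1K.
apply: eq_bigl => B; rewrite !inE eqxx /=; apply/eqP/idP => [<-|uB].
  by rewrite !inE eqxx.
by rewrite setU1K.
Qed.

(** If [f] vanishes off cliques, this is a weighted clique count in the blow-up that replaces each
    [v] by [y v] pairwise non-adjacent twins. *)
Definition wsum f y := \sum_(B : {set V}) f B * \prod_(v in B) y v.

Lemma wsum_split1 f y u : wsum f y =
  \sum_(B : {set V} | u \notin B)
    (\prod_(v in B) y v) * (f B + y u * f (u |: B)).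
Proof.
rewrite /wsum (big_setU1_split u); apply: eq_bigr => B uB.
by rewrite big_setU1 //=; lia.
Qed.

Lemma wsum_split2 f y u v : u != v -> wsum f y =
  \sum_(B : {set V} | (u \notin B) && (v \notin B))
    (\prod_(w in B) y w) *
    (f B + y u * f (u |: B) + y v * f (v |: B) + y u * y v * f (u |: (v |: B))).
Proof.
move=> neq; rewrite (wsum_split1 f y u) big_mkcond (big_setU1_split v).
rewrite [LHS]big_mkcond [RHS]big_mkcond /=; apply: eq_bigr => B _.
rewrite !inE negb_or neq /=; case: (boolP (v \in B)) => vB;
  case: (u \in B) => //=.
by rewrite big_setU1 //=; nia.
Qed.

Definition transfer y u v a b w :=
  if w == u then a else if w == v then b else y w.

Lemma sum_transfer y u v a b : u != v -> a + b = y u + y v ->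
  \sum_w transfer y u v a b w = \sum_w y w.
Proof.
move=> neq ab; rewrite (bigD1 u) // (bigD1 v) 1?eq_sym //=.
rewrite [RHS](bigD1 u) //= [in RHS](bigD1 v) 1?eq_sym //= !addnA -ab.
rewrite /transfer eqxx eq_sym (negPf neq) eqxx; congr (_ + _).
by apply: eq_bigr => w /andP[/negPf -> /negPf ->].
Qed.

Lemma wsum_transfer f y u v a b : u != v -> wsum f (transfer y u v a b) =
  \sum_(B : {set V} | (u \notin B) && (v \notin B))
    (\prod_(w in B) y w) *
    (f B + a * f (u |: B) + b * f (v |: B) + a * b * f (u |: (v |: B))).
Proof.
move=> neq; rewrite (wsum_split2 _ _ neq); apply: eq_bigr => B /andP[uB vB].
rewrite {2 3 4 5}/transfer eqxx [v == u]eq_sym (negPf neq) eqxx; congr (_ * _).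
apply: eq_bigr => w wB; rewrite /transfer.
by case: eqP => [E|_]; [rewrite -E wB in uB | case: eqP => // E;
  rewrite -E wB in vB].
Qed.
End Multilinear.

(** * Balancing the parts of a complete multipartite graph *)

Section Balance.
Variable x : nat.

Lemma sum_turan_part m : 0 < x -> \sum_(j < x) turan_part m j = m.
Proof.
move=> x0; rewrite /turan_part big_split /= sum_nat_const card_ord.
have main k : \sum_(j < k) (j < m %% x) = minn k (m %% x).
  by elim: k => [|k IH]; rewrite ?big_ord0 ?min0n // big_ord_recr /= IH; lia.
rewrite main {3}(divn_eq m x) mulnC; have := ltn_pmod m x0; lia.
Qed.

(* For [c i = 'C(q, s - i)] this is the number of [s]-cliques of the join of
   [K_q] with the Turan graph on [m] vertices. *)
Definition turan_sum (c : nat -> nat) m :=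
  wsum (fun I : {set 'I_x} => c #|I|) (fun j => turan_part m j).

(** Moving a unit from an overfull part to an underfull one keeps the sum of the two sizes and does
    not decrease their product, so the symmetric multilinear sum does not decrease; the total excess
    over the Turan sizes drops. *)
Lemma wsum_balance c (z : 'I_x -> nat) :
  wsum (fun I : {set 'I_x} => c #|I|) z <= turan_sum c (\sum_j z j).
Proof.
have [m Em] : exists m, \sum_j z j = m by exists (\sum_j z j).
have [d] := ubnP (\sum_(j < x) (z j - turan_part m j)).
elim: d z Em => [//|d IH] z Em lt; rewrite Em.
have [/existsP[a za]|/existsPn nza] := boolP [exists a, turan_part m a < z a].
  have x0 : 0 < x by apply: leq_ltn_trans (ltn_ord a).
  have [/existsP[b zb]|/existsPn nzb] := boolP [exists b, z b < turan_part m b].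
    have neq : a != b by apply/eqP=> E; subst b; lia.
    (* Turan parts differ by at most one, so the move does not overshoot. *)
    have gap : z b < z a.
      by move: za zb; rewrite /turan_part; do 2!case: (_ < m %% x)%N; lia.
    pose z' := transfer z a b (z a).-1 (z b).+1.
    have Ez' : \sum_j z' j = m by rewrite sum_transfer //; lia.
    have dec : \sum_(j < x) (z' j - turan_part m j) < \sum_(j < x) (z j -
      turan_part m j).
      rewrite (bigD1 a) //= [ltnRHS](bigD1 a) //= -addSn leq_add //.
        by rewrite /z' /transfer eqxx; lia.
      apply: leq_sum => j ja; rewrite /z' /transfer (negPf ja).
      by case: eqP => [->|] //; lia.
    rewrite -Ez'; apply: leq_trans (IH z' Ez' _); last by lia.
    rewrite (wsum_split2 _ _ neq) (wsum_transfer _ _ _ _ neq).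
    apply: leq_sum => B /andP[aB bB]; rewrite leq_mul2l; apply/orP; right.
    rewrite !cardsU1 !inE (negPf neq) aB bB /=.
    have : z a * z b <= (z a).-1 * (z b).+1 by nia.
    have : (z a).-1 + (z b).+1 = z a + z b by lia.
    move: (z a) (z b) ((z a).-1) ((z b).+1) => p q p' q' E le.
    by nia.
  exfalso; have : \sum_j z j > \sum_(j < x) turan_part m j.
    rewrite (bigD1 a) //= [ltnRHS](bigD1 a) //= -addSn leq_add //.
    by apply: leq_sum => j _; have := nzb j; lia.
  by rewrite Em sum_turan_part //; lia.
have zE j : z j = turan_part m j.
  have x0 : 0 < x by apply: leq_ltn_trans (ltn_ord j).
  apply/eqP; rewrite eqn_leq leqNgt nza /= leqNgt; apply/negP=> ltj.
  have : \sum_j z j < \sum_(j < x) turan_part m j.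
    rewrite (bigD1 j) //= [ltnRHS](bigD1 j) //= -addSn leq_add //.
    by apply: leq_sum => i _; have := nza i; lia.
  by rewrite Em sum_turan_part //; lia.
by apply: eq_leq; apply: eq_bigr => I _; congr (_ * _); apply: eq_bigr.
Qed.

End Balance.

(** * The weighted Zykov theorem *)

Section Zykov.
Variables (V : finType) (e : rel V).

(* Zykov symmetrisation: the sum is multilinear in [y] and has no term with
   both of two non-adjacent vertices, so the weight of one of them can be moved
   to the other; hence the support may be assumed to be a clique. *)
Lemma zykov x (c : nat -> nat) (y : V -> nat) :
  (forall B, clique e B -> #|B| = x.+1 -> exists2 v, v \in B & y v = 0) ->
  wsum (fun B => clique e B * c #|B|) y <= turan_sum x c (\sum_v y v).
Proof.
pose supp (y : V -> nat) := [set v | 0 < y v].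
have [d] := ubnP #|supp y|; elim: d y => [//|d IH] y ltd noK.
have [clS|nclS] := boolP (clique e (supp y)); last first.
  have [u [v [yu yv neq nuv]]] :
      exists u, exists v, [/\ 0 < y u, 0 < y v, u != v & ~~ e u v].
    move: nclS; rewrite negb_forall_in => /exists_inP[u]; rewrite inE => yu.
    rewrite negb_forall_in => /exists_inP[v]; rewrite inE => yv.
    by rewrite negb_imply => /andP[neq nuv]; exists u, v.
  have f0 B : clique e (u |: (v |: B)) * c #|u |: (v |: B)| = 0.
    rewrite [clique _ _](_ : _ = false) //; apply/negP=> /cliqueP h.
    by move/negP: nuv; apply; apply: h; rewrite // !inE eqxx ?orbT.
  (* One of [a] and [b] is 0, so the support loses a vertex and the induction hypothesis applies. *)
  have step a b : a + b = y u + y v -> minn a b = 0 ->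
      wsum (fun B => clique e B * c #|B|) (transfer y u v a b) <=
      turan_sum x c (\sum_v y v).
    move=> ab ab0; rewrite -(sum_transfer neq ab); apply: IH.
      apply: leq_trans (proper_card _) ltd.
      rewrite properE; apply/andP; split.
        apply/subsetP=> w; rewrite !inE /transfer; case: eqP => [->//|_].
        by case: eqP => [->|].
      apply/subsetPn; have [a0|b0] : a = 0 \/ b = 0 by lia.
        by exists u; rewrite !inE // /transfer eqxx a0.
      by exists v; rewrite !inE // /transfer eq_sym (negPf neq) eqxx b0.
    move=> B clB cB; have [w wB yw] := noK _ clB cB; exists w => //.
    rewrite /transfer; case: eqP => [E|_]; first by rewrite E in yw; lia.
    by case: eqP => [E|//]; first by rewrite E in yw; lia.
  have h1 := step (y u + y v) 0 (addn0 _) (minn0 _).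
  have h2 := step 0 (y u + y v) (add0n _) (min0n _).
  move: h1 h2; set f := (fun B => clique e B * c #|B|) => h1 h2.
  have f1 B : f (u |: (v |: B)) = 0 by apply: f0.
  pose S (g : {set V} -> nat) := \sum_(B : {set V} | (u \notin B)
    && (v \notin B))
    (\prod_(w in B) y w) * g B.
  have lin a b : \sum_(B : {set V} | (u \notin B) && (v \notin B))
      (\prod_(w in B) y w) * (f B + a * f (u |: B) + b * f (v |: B) +
                              a * b * f (u |: (v |: B))) =
      S f + a * S (fun B => f (u |: B)) + b * S (fun B => f (v |: B)).
    rewrite /S !big_distrr -!big_split; apply: eq_bigr => B _ /=.
    by rewrite f1; lia.
  (* By [f1] the sum is linear along the transfer, so moving all the weight to the vertex with the
     larger of [Su] and [Sv] does not decrease it. *)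
  move: h1 h2; rewrite !wsum_transfer // (wsum_split2 _ _ neq) !lin.
  move: (S f) (S _) (S _) (turan_sum _ _ _) => P Su Sv N h1 h2.
  by have [le|le] := leqP Su Sv; nia.
have leS : #|supp y| <= x.
  rewrite leqNgt; apply/negP=> gt.
  have [||B [_ BS cB]] := @subset_of_card _ set0 (supp y) x.+1.
  - exact: sub0set.
  - by rewrite cards0.
  have [v vB] := noK _ (cliqueS BS clS) cB.
  by move/(subsetP BS): vB; rewrite inE; lia.
have -> : wsum (fun B => clique e B * c #|B|) y =
    \sum_(B : {set V} | B \subset supp y) c #|B| * \prod_(v in B) y v.
  rewrite /wsum [RHS]big_mkcond; apply: eq_bigr => B _.
  case: ifP => [BS|/negbT /subsetPn[v vB]];
    first by rewrite (cliqueS BS clS) mul1n.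
  by rewrite inE -eqn0Ngt => /eqP yv; rewrite (bigD1 v) //= yv muln0.
have -> : \sum_v y v = \sum_(v in supp y) y v.
  rewrite [RHS]big_mkcond; apply: eq_bigr => v _; rewrite inE.
  by case: (posnP (y v)).
have [S0|[v0 v0S]] := set_0Vmem (supp y).
  rewrite S0 (eq_bigl (pred1 set0)); last by move=> B; rewrite subset0.
  rewrite big_pred1_eq /turan_sum /wsum !big_set0 (bigD1 set0) //=.
  by rewrite !cards0 big_set0 leq_addr.
(* Each vertex of the clique [supp y] becomes a part of size [y v]; indices outside the image of [h]
   receive size 0. *)
pose h v : 'I_x := widen_ord leS (enum_rank_in v0S v).
have hinj : {in supp y &, injective h}.
  move=> u v uS vS /(congr1 val) /= E.
  by apply: (@enum_rank_in_inj _ _ _ _ v0S v0S) => //; apply: val_inj.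
pose z j := \sum_(v in supp y | h v == j) y v.
have zh v : v \in supp y -> z (h v) = y v.
  move=> vS; rewrite /z (eq_bigl (pred1 v)) ?big_pred1_eq // => w /=.
  apply/andP/eqP => [[wS /eqP E]|->]; last by rewrite eqxx.
  exact: hinj.
have -> : \sum_(v in supp y) y v = \sum_j z j by rewrite -partition_big.
apply: leq_trans (wsum_balance c z); rewrite /wsum.
have inj2 : {in [pred B : {set V} | B \subset supp y] &,
  injective (fun B : {set V} => h @: B)}.
  move=> B B'; rewrite !inE => BS BS' E; apply/setP=> v.
  have sub (C C' : {set V}) : C \subset supp y -> C' \subset supp y ->
      h @: C = h @: C' -> v \in C -> v \in C'.
    move=> CS CS' EC vC; have : h v \in h @: C' by rewrite -EC imset_f.
    case/imsetP=> w wC' /hinj -> //; first exact: (subsetP CS).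
    exact: (subsetP CS').
  by apply/idP/idP; apply: sub.
have -> : \sum_(B : {set V} | B \subset supp y) c #|B| * \prod_(v in B) y v =
    \sum_(B in [pred B : {set V} | B \subset supp y])
       c #|h @: B| * \prod_(j in h @: B) z j.
  apply: eq_big => [B|B BS]; first by rewrite inE.
  have hB : {in B &, injective h} by apply: sub_in2 hinj; apply/subsetP.
  rewrite card_in_imset // big_imset //=; congr (_ * _).
  by apply: eq_bigr => v vB; rewrite zh // (subsetP BS).
rewrite -(big_imset (fun I : {set 'I_x} =>
  c #|I| * \prod_(j in I) z j) inj2) /=.
by rewrite big_mkcond; apply: leq_sum => I _; case: ifP.
Qed.
End Zykov.

(** * Numerical estimates *)

Section Arith.

(** A discrete mean value bound: shifting the base by a constant costs only a term of lower
    order. *)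
Lemma expn_addl_bound m d x : (m + d) ^ x <= m ^ x + d * x * (m + d) ^ x.-1.
Proof.
elim: x => [|x IH]; first by rewrite !expn0 muln0.
rewrite succnK !expnS; case: x IH => [|x] IH; first by rewrite !expn0; lia.
rewrite succnK in IH; rewrite expnS in IH *; move: IH.
move: (m ^ x.+1) ((m + d) ^ x) => u w; nia.
Qed.

Lemma AGM_nat x (f : 'I_x -> nat) : x ^ x * \prod_j f j <= (\sum_j f j) ^ x.
Proof.
have := @Num.Theory.leif_AGM_scaled int 'I_x predT (fun j => (f j)%:R%R).
move=> /(_ _) [|le _]; first by move=> j _;
  rewrite -GRing.mulrnA Num.Theory.ler0n.
move: le; rewrite -(Num.Theory.ler_nat int) GRing.natrX GRing.natrM.
rewrite GRing.natrX GRing.natr_sum GRing.natr_prod cardT size_enum_ord.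
apply: Order.POrderTheory.le_trans.
rewrite GRing.prodrMn_const cardT size_enum_ord -[in leLHS]GRing.natrX.
by rewrite GRing.mulr_natl.
Qed.

(** Only the full index set survives; its term is the product of all part sizes, bounded by the
    inequality of arithmetic and geometric means. *)
Lemma turan_sum_top_upper x m : 0 < x ->
  x ^ x * turan_sum x (fun i => i == x) m <= m ^ x.
Proof.
move=> x0; rewrite -[m in leqRHS](sum_turan_part m x0).
apply: leq_trans (AGM_nat _); rewrite leq_mul2l; apply/orP; right.
rewrite /turan_sum /wsum (bigD1 setT) //= cardsT card_ord eqxx mul1n.
rewrite [X in _ + X]big1 ?addn0 => [|I IT].
  by apply: eq_leq; apply: eq_bigl => j; rewrite inE.
by case: eqP => // cI; case/negP: IT;
  rewrite eqEcard subsetT cardsT card_ord cI leqnn.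
Qed.

(** Keep only the term of the full index set; every part has at least [m %/ x] vertices. *)
Lemma turan_sum_lower x c m : (m - x) ^ x * c x <= x ^ x * turan_sum x c m.
Proof.
rewrite /turan_sum /wsum (bigD1 setT) //= cardsT card_ord.
have [->|x0] := posnP x; first
  by rewrite !expn0 !mul1n big1 ?muln1 ?leq_addr // => [[]].
apply: (@leq_trans (x ^ x * (c x * \prod_(j < x) (m %/ x)))).
  rewrite prod_nat_const card_ord mulnC mulnCA leq_mul2l -expnMn.
  rewrite leq_exp2r //; apply/orP; right.
  have := divn_eq m x; have := ltn_pmod m x0.
  by move: (m %/ x) (m %% x) => u w; lia.
rewrite leq_mul2l; apply/orP; right.
apply: leq_trans (leq_addr _ _); rewrite leq_mul2l; apply/orP; right.
rewrite [leqRHS](eq_bigl predT) => [|j]; last by rewrite inE.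
by apply: leq_prod => j _; rewrite leq_addr.
Qed.

End Arith.

(** * Kernels, their union and their degrees *)

Section Structure.
Variables (V : finType) (e : rel V).
Hypothesis e_sym : symmetric e.
Variables (x p a t : nat).
Hypotheses (p0 : 0 < p) (t2 : 1 < t) (lo : t * p.-1 < a) (hi : a < t * p).
Hypothesis x0 : 0 < x.
Implicit Types (A B E K R S Y Z : {set V}).

Local Notation r := (p + x).
Local Notation s := (a + x).
Local Notation q := (t * p).-1.
Local Notation N := #|V|.+1.
Local Notation M := (t * r).+1.

Hypothesis free : ~~ packing (kclique e r) t set0.

Definition kcliques k := [set E | kclique e k E].

Definition deg A := #|[set E in kcliques s | A \subset E]|.

Definition common_nbrs A := [set v | (v \notin A) && [forall u in A, e u v]].

(* Among [M = t * r + 1] disjoint petals one avoids any given [t * r] vertices. *)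
Definition kernels := [set A : {set V} | (#|A| == a) &&
  packing (fun B => (#|B| == x) && clique e (A :|: B)) M A].

Definition core := \bigcup_(A in kernels) A.

Lemma common_nbrs_disjoint A : [disjoint common_nbrs A & A].
Proof. by apply/disjointsP=> v; rewrite inE => /andP[/negP]. Qed.

Lemma clique_common_nbrs A B :
  clique e A -> clique e B -> B \subset common_nbrs A -> clique e (A :|: B).
Proof.
move=> clA clB /subsetP BN; apply: cliqueU => // u v uA /BN.
by rewrite inE => /andP[_ /forall_inP h] _; apply: h.
Qed.

Lemma clique_sub_common_nbrs A E : clique e E -> A \subset E ->
  E :\: A \subset common_nbrs A.
Proof.
move=> /cliqueP clE AE; apply/subsetP=> v; rewrite !inE => /andP[vA vE].
rewrite vA; apply/forall_inP=> u uA; apply: clE => //;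
  first exact: (subsetP AE).
by apply: contraNneq vA => <-.
Qed.

Lemma kernels_clique A : A \in kernels -> clique e A.
Proof.
rewrite inE => /andP[_ /existsP[B /andP[/andP[_ clB] _]]].
by apply: cliqueS clB; apply: subsetUl.
Qed.

Lemma card_kernel A : A \in kernels -> #|A| = a.
Proof. by rewrite inE => /andP[/eqP]. Qed.

Lemma card_deg K m : s - #|K| <= m -> #|K| <= s -> deg K <= N ^ m.
Proof.
move=> le Ks; apply: leq_trans (_ : N ^ (s - #|K|) <= _);
  last exact: leq_pexp2l.
apply: card_supersets => // E; rewrite !inE => /andP[/andP[_ /eqP ->] ->].
by rewrite leqnn.
Qed.

(** Let [K] be the centre of a sunflower with [M] petals among these cliques. If [#|K| = a], then
    [K] is a kernel inside its members; if [#|K| < a], the petals have more than [x] vertices and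
    [t] of them yield disjoint [r]-cliques. *)
Lemma few_unkernelled :
  #|[set E in kcliques s | ~~ [exists A in kernels, A \subset E]]| <=
  (M * s + s) ^ a.+1 * N ^ x.-1.
Proof.
have -> : a.+1 = (s - x).+1 by lia.
apply: card_sunflower_free => [|E|K cK].
- by rewrite x0 leq_addl.
- by rewrite !inE => /andP[/andP[_ /eqP]].
apply/negP=> pk.
have pk' m : m <= M -> packing (fun B =>
  (#|B| == s - #|K|) && clique e (K :|: B)) m K.
  move=> leM; have := packing_leq leM pk.
  have dK B : [disjoint B & K] ->  K :|: B \in [set E in kcliques s |
      ~~ [exists A in kernels, A \subset E]] -> (#|B| == s - #|K|)
        && clique e (K :|: B).
    move=> dBK; rewrite !inE => /andP[/andP[-> /eqP cE] _]; rewrite andbT.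
    by move: cE; rewrite cardsU setIC (disjoint_setI0 dBK) cards0; lia.
  have main k Z : K \subset Z -> packing (fun B =>
    K :|: B \in [set E in kcliques s |
      ~~ [exists A in kernels, A \subset E]]) k Z ->
      packing (fun B => (#|B| == s - #|K|) && clique e (K :|: B)) k Z.
    elim: k Z => [//|k IH] Z KZ /existsP[B /and3P[h1 h2 h3]].
    apply: (packingS (R := B)) => //; first by apply: dK => //;
      apply: disjointWr h2.
    by apply: IH h3; apply: subset_trans KZ (subsetUr _ _).
  exact: main.
have [cKa|ncK] := eqVneq #|K| a.
  have KF : K \in kernels.
    by rewrite inE cKa eqxx /=; have := pk' M (leqnn _); rewrite cKa addKn.
  case/existsP: pk => B /andP[]; rewrite !inE => /andP[_ /negP h] _; apply: h.
  by apply/exists_inP; exists K => //; apply: subsetUl.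
move/negP: free; apply.
have tM : t <= M by nia.
(* Each clique takes [p - (a - #|K|)] vertices of the centre, and [t * p.-1 < a] makes [t] times
   that at most [#|K|]. *)
apply: packing_sunflower (pk' _ tM) => //.
move: cK ncK lo hi; rewrite addnK; move: #|K| => k.
case: (p) p0 => // j _ /= ka ne lo' _.
have [d Ed] : exists d, a = k + d.+1 by exists (a - k).-1; lia.
have -> : j.+1 + x - (a + x - k) = j - d by lia.
have [|jd] := leqP j d; first by rewrite -subn_eq0 => /eqP ->; rewrite muln0.
have [i Ei] : exists i, j = i + d by exists (j - d); lia.
subst j; rewrite addnK; nia.
Qed.

Lemma card_core : #|core| <= q.
Proof.
rewrite leqNgt; apply/negP=> lt; move/negP: free; apply.
apply: (@packing_extend _ _ kernels r p x M) => //.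
- by move=> A; rewrite inE => /andP[].
- by rewrite cards0.
apply: (@packing_cover _ _ p t (enum kernels)) => // [A R|A|].
- rewrite mem_enum => AF RA ->; rewrite eqxx /=.
  by apply/exists_inP; exists A.
- by rewrite mem_enum => /card_kernel; rewrite setD0 => ->.
by rewrite setD0 big_enum /=; move: lt; rewrite -/core; lia.
Qed.

Lemma card_kcliques_deg : #|kcliques s| <=
  \sum_(A in kernels) deg A + (M * s + s) ^ a.+1 * N ^ x.-1.
Proof.
rewrite -(cardsID [set E : {set V} | [exists A in kernels,
  A \subset E]] (kcliques s)).
apply: leq_add; last first.
  apply: leq_trans few_unkernelled; apply: subset_leq_card.
  by apply/subsetP=> E; rewrite !inE andbC.
apply: (@leq_trans #|\bigcup_(A in kernels) [set E in kcliques s | A \subset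
  E]|).
  apply: subset_leq_card; apply/subsetP=> E; rewrite !inE => /andP[Es].
  by case/exists_inP=> A AF AE; apply/bigcupP; exists A; rewrite // !inE Es.
exact: card_bigcup_sum.
Qed.

Definition cliques_in k (D : {set V}) := [set B | kclique e k B
  && (B \subset D)].

(** The weights are the indicator of [D], and only the coefficient of order [x] is nonzero. *)
Lemma cliques_in_zykov D : cliques_in x.+1 D = set0 ->
  x ^ x * #|cliques_in x D| <= #|D| ^ x.
Proof.
move=> noK; apply: leq_trans (turan_sum_top_upper _ x0).
rewrite leq_mul2l; apply/orP; right.
have -> : #|D| = \sum_v (v \in D) by rewrite -sum1_card big_mkcond.
have noK' B : clique e B -> #|B| = x.+1 -> exists2 v,
  v \in B & (v \in D : nat) = 0.
  move=> clB cB; have : B \notin cliques_in x.+1 D by rewrite noK inE.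
  rewrite inE /kclique clB cB eqxx /= => /subsetPn[v vB /negPf vD].
  by exists v; rewrite // vD.
apply: leq_trans (zykov (fun i => i == x) noK').
rewrite -sum1_card big_mkcond; apply: leq_sum => B _; rewrite inE.
case: ifP => // /andP[/andP[-> ->] /subsetP BD].
by rewrite big1 // => v /BD ->.
Qed.

(** A clique with [E :\: A] inside [D] is determined by an [x]-clique of [D]; any other contains [A]
    and one of at most [m] further vertices, which leaves [x.-1] to choose. *)
Lemma deg_split A D m : A \in kernels ->
  #|common_nbrs A :\: D| <= m ->
  deg A <= #|cliques_in x D| + m * N ^ x.-1.
Proof.
move=> AF lem; rewrite /deg -(cardsID [set E : {set V} | E :\: A \subset D]).
have cA := card_kernel AF.
apply: leq_add.
  have inj : {in [set E in kcliques s | A \subset E] :&: [set E : {set V} | E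
    :\: A \subset D] &,
      injective (fun E : {set V} => E :\: A)}.
    move=> E E'; rewrite !inE => /andP[/andP[_ AE] _] /andP[/andP[_ AE'] _] eqE.
    by rewrite -(setID E A) -(setID E' A) eqE (setIidPr AE) (setIidPr AE').
  rewrite -(card_in_imset inj); apply: subset_leq_card.
  apply/subsetP=> _ /imsetP[E + ->];
    rewrite !inE => /andP[/andP[/andP[clE /eqP cE] AE] ED].
  rewrite ED andbT /kclique (cliqueS (subsetDl _ _) clE) cardsDS // cE cA.
  by rewrite addKn eqxx.
apply: (card_meeting (Y := common_nbrs A :\: D)) => // [E|v vY].
  rewrite !inE => /andP[/subsetPn[v vE vD] /andP[/andP[clE _] AE]].
  apply/negP=> /disjointsP/(_ v); apply; first by move: vE;
    rewrite inE => /andP[].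
  by rewrite inE vD (subsetP (clique_sub_common_nbrs clE AE)).
have vA : v \notin A by move: vY; rewrite !inE => /and3P[].
have cvA : #|v |: A| = a.+1 by rewrite cardsU1 vA cA.
apply: leq_trans (card_deg (K := v |: A) _ _); rewrite ?cvA; try lia.
apply: subset_leq_card; apply/subsetP=> E; rewrite !inE subUset sub1set.
by case/andP=> /andP[_ /andP[-> ->]] ->.
Qed.

(** As [t * p.-1 < a], [t] disjoint petals of order [x.+1] around [A] would give [t] disjoint
    [r]-cliques. So a set [Y] of at most [a + t * x.+1] vertices blocks them, and off [Y] the common
    neighbourhood has no [x.+1]-clique. *)
Lemma deg_kernel A : A \in kernels ->
  x ^ x * deg A <= #|common_nbrs A| ^ x + x ^ x * (a + t * x.+1) * N ^ x.-1.
Proof.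
move=> AF; pose PB B := (#|B| == x.+1) && clique e (A :|: B).
have nP : ~~ packing PB t A.
  apply: contra free; apply: packing_sunflower => //.
  have -> : p + x - x.+1 = p.-1 by lia.
  by rewrite (card_kernel AF) ltnW.
have [|Y [cY AY meetY]] := packing_blocking (m := x.+1) _ nP.
  by move=> R /andP[/eqP ->].
rewrite (card_kernel AF) in cY.
have := @deg_split A (common_nbrs A :\: Y) (a + t * x.+1) AF.
have -> : common_nbrs A :\: (common_nbrs A :\: Y) = common_nbrs A :&: Y.
  by apply/setP=> v; rewrite !in_setD in_setI; case: (v \in Y);
    case: (v \in common_nbrs A).
have leY : #|common_nbrs A :&: Y| <= a + t * x.+1.
  by apply: leq_trans cY; rewrite subset_leq_card // subsetIr.
move=> /(_ leY) /(leq_mul (leqnn (x ^ x))) h.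
apply: leq_trans h _; rewrite mulnDr mulnA leq_add2r.
apply: leq_trans (cliques_in_zykov _) _; last first.
  by rewrite leq_exp2r // subset_leq_card // subsetDl.
apply/setP=> B; rewrite !inE; apply/negP=> /andP[/andP[clB cB] BD].
have dBY : [disjoint B & Y].
  by apply: disjointWl BD _; apply/disjointsP=> v; rewrite inE => /andP[/negP].
suff PBB : PB B by have := meetY B PBB; rewrite dBY.
rewrite /PB cB; apply: clique_common_nbrs => //; first exact: kernels_clique.
exact: subset_trans BD (subsetDl _ _).
Qed.

(** * Consequences of having more cliques than the optimum *)

Local Notation c := 'C(q, a).
Local Notation D := (N ^ x.-1).

(** These constants depend only on [x], [p], [a] and [t]. The defects of degrees and of clique
    counts are coefficients of [D] in error terms; [nbrs_defect] and [outside_bound] bound numbers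
    of vertices. *)
Definition deg_defect := x ^ x * (a + t * x.+1).
Definition kernel_defect := c * deg_defect + (x ^ x * (M * s + s) ^ a.+1
  + c * ((q + x).+1 * x)).
Definition nbrs_defect := kernel_defect + deg_defect.
Definition outside_bound := q + c * nbrs_defect.
Definition nbrs_clique_defect := x ^ x * outside_bound + kernel_defect.

Lemma expnN : N ^ x = N * D.
Proof. by rewrite -expnS prednK. Qed.

Lemma deg_kernel_le A : A \in kernels ->
  x ^ x * deg A <= N * D + deg_defect * D.
Proof.
move=> AF; apply: leq_trans (deg_kernel AF) _; rewrite leq_add2r -expnN.
by rewrite leq_exp2r // ltnW // ltnS max_card.
Qed.

Lemma kernels_draws :
  kernels \subset [set A : {set V} | A \subset core & #|A| == a].
Proof.
apply/subsetP=> A AF; rewrite inE (card_kernel AF) eqxx andbT.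
exact: bigcup_sup.
Qed.

Lemma card_kernels : #|kernels| <= c.
Proof.
apply: leq_trans (subset_leq_card kernels_draws) _.
by rewrite cards_draws leq_bin2l // card_core.
Qed.

Lemma a_gt0 : 0 < a. Proof. lia. Qed.
Lemma a_leq_q : a <= q. Proof. lia. Qed.
Lemma c_gt0 : 0 < c. Proof. by rewrite bin_gt0 a_leq_q. Qed.

(* [s - i] is truncated, but [i <= x] for all terms of the sum. *)
Local Notation optimum := (turan_sum x (fun i => 'C(q, s - i)) (#|V| - q)).

Hypothesis many : optimum < #|kcliques s|.
Hypothesis large : kernel_defect < N.

(** The optimum has leading term [c * (N / x) ^ x], while the cliques without a kernel contribute
    only a multiple of [D]. The factor [x ^ x] clears denominators. *)
Lemma sum_deg_lower : c * (N * D) <= \sum_(A in kernels) x ^ x * deg A +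
   (x ^ x * (M * s + s) ^ a.+1 + c * ((q + x).+1 * x)) * D.
Proof.
have le1 := turan_sum_lower x (fun i => 'C(q, s - i)) (#|V| - q).
rewrite /= addnK in le1.
have le2 := card_kcliques_deg; rewrite -big_distrr /=.
(* If the subtraction truncates, the error term alone is at least [N * D]. *)
have le3 : N * D <= (#|V| - q - x) ^ x + (q + x).+1 * x * D.
  rewrite -expnN; have [leV|ltV] := leqP (q + x) #|V|.
    have := expn_addl_bound (#|V| - q - x) (q + x).+1 x.
    by have -> : #|V| - q - x + (q + x).+1 = N by lia.
  apply: leq_trans (leq_addl _ _); rewrite expnN leq_mul2r.
  by apply/orP; right; apply: leq_trans (leq_pmulr _ x0); lia.
move: le1 le2 le3 many.
move: (turan_sum _ _ _) (#|V| - q - x) (\sum_(A in kernels) _) #|kcliques s|.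
move=> O d S K le1 le2 le3 lt.
have h1 : c * (N * D) <= c * d ^ x + c * ((q + x).+1 * x) * D.
  by rewrite -mulnA -mulnDr leq_mul2l le3 orbT.
have h2 : x ^ x * O <= x ^ x * (S + (M * s + s) ^ a.+1 * D).
  by rewrite leq_mul2l; apply/orP; right; apply: leq_trans le2; apply: ltnW.
move: h1 h2 le1; move: D (_ ^ a.+1) (x ^ x) (d ^ x) c ((q + x).+1 * x) #|V|.+1.
by move=> b u v w k y n; clear; lia.
Qed.

(** Each kernel accounts for at most [N * D] up to an error, so [c.-1] of them fall short of
    [sum_deg_lower] once [N] exceeds [kernel_defect]. *)
Lemma kernels_full : #|kernels| = c.
Proof.
apply/eqP; rewrite eqn_leq card_kernels leqNgt; apply/negP=> lt.
have := sum_deg_lower; rewrite leqNgt => /negP; apply.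
have : \sum_(A in kernels) x ^ x * deg A <= c.-1 * (N * D + deg_defect * D).
  apply: leq_trans (_ : \sum_(A in kernels) (N * D + deg_defect * D) <= _).
    by apply: leq_sum => A; apply: deg_kernel_le.
  by rewrite sum_nat_const leq_mul2r; apply/orP; right;
    rewrite -ltnS prednK ?c_gt0.
have D0 : 0 < D by rewrite expn_gt0.
have := large; rewrite /kernel_defect; have := c_gt0.
set u := x ^ x * (M * s + s) ^ a.+1 + _; move: u => u.
move: (\sum_(A in kernels) _) c deg_defect => S k w; move: D D0 => d d0;
  move: N => n.
case: k => // k _ /= lt1 le1;
  have : (k.+1 * w + u) * d < n * d by rewrite ltn_mul2r d0.
have := leq0n (w * d); lia.
Qed.

Lemma deg_lower A : A \in kernels -> N * D <= x ^ x * deg A + kernel_defect * D.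
Proof.
move=> AF; have := sum_deg_lower; rewrite (bigD1 A) //=.
have : \sum_(B in kernels | B != A) x ^ x * deg B <= c.-1 * (N * D
  + deg_defect * D).
  apply: leq_trans (_ : \sum_(B in kernels | B != A) (N * D
    + deg_defect * D) <= _).
    by apply: leq_sum => B /andP[BF _]; apply: deg_kernel_le.
  rewrite sum_nat_const leq_mul2r; apply/orP; right.
  rewrite -kernels_full (cardsD1 A kernels) AF /= subset_leq_card //.
  by apply/subsetP=> B /andP[BF BA]; rewrite in_setD1 BA.
rewrite /kernel_defect; have := c_gt0.
set u := x ^ x * (M * s + s) ^ a.+1 + _; move: u => u.
move: (\sum_(B in kernels | _) _) (x ^ x * deg A) c deg_defect => S g k w.
by move: D => d; move: N => n; case: k => // k _ /=; have := leq0n (w * d); lia.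
Qed.

(** [deg_lower] and [deg_kernel] bound [#|common_nbrs A| ^ x] from below; this power is at most
    [#|common_nbrs A| * D], and [D] cancels. *)
Lemma card_common_nbrs A : A \in kernels -> N <= #|common_nbrs A| + nbrs_defect.
Proof.
move=> AF; have h1 := deg_lower AF; have := deg_kernel AF;
  rewrite -/deg_defect => h2.
have D0 : 0 < D by rewrite expn_gt0.
have h3 : #|common_nbrs A| ^ x <= #|common_nbrs A| * D.
  rewrite -{1}(prednK x0) expnS leq_mul2l; apply/orP; right.
  have [->|x1] := posnP x.-1; first by rewrite !expn0.
  by rewrite leq_exp2r // ltnW // ltnS max_card.
rewrite -(leq_pmul2r D0) mulnDl /nbrs_defect mulnDl; lia.
Qed.

(** A smaller core would have fewer than [c] subsets of order [a], hence too few kernels. *)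
Lemma card_core_eq : #|core| = q.
Proof.
apply/eqP; rewrite eqn_leq card_core leqNgt; apply/negP=> lt.
have := subset_leq_card kernels_draws; rewrite cards_draws kernels_full.
rewrite leqNgt => /negP; apply.
apply: (@leq_ltn_trans 'C(q.-1, a)); first by apply: leq_bin2l; lia.
have := a_leq_q; have := a_gt0; case: (q) (a) => [|q'] [|a'] //= _ le.
by rewrite binS -addn1 leq_add2l bin_gt0.
Qed.

Lemma kernelsE A : (A \in kernels) = (A \subset core) && (#|A| == a).
Proof.
suff -> : kernels = [set A : {set V} | A \subset core & #|A| == a]
  by rewrite inE.
by apply/eqP; rewrite eqEcard kernels_draws cards_draws card_core_eq
  kernels_full leqnn.
Qed.

Lemma sub_kernel B : B \subset core -> #|B| <= a ->
  exists2 A, A \in kernels & B \subset A.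
Proof.
move=> BQ leB; have [|A [BA AQ cA]] := @subset_of_card _ B core a BQ.
  by rewrite leB card_core_eq a_leq_q.
by exists A; rewrite // kernelsE AQ cA eqxx.
Qed.

(** Otherwise some [r]-clique [R1] inside [R] uses at most [p.-1] core vertices. The other
    [t.-1 * p] or more contain [t.-1] disjoint [p]-sets, each inside a kernel, and petals avoiding
    [R1] extend them to [r]-cliques. *)
Lemma clique_outside_core R : clique e R -> r <= #|R| -> #|R :\: core| <= x.
Proof.
move=> clR ler; rewrite leqNgt; apply/negP=> lt.
have [||R' [_ R'R cR']] := @subset_of_card _ set0 (R :\: core) x.+1.
- exact: sub0set.
- by rewrite cards0.
have R'R0 : R' \subset R by apply: subset_trans R'R (subsetDl _ _).
have [|R1 [R'1 R1R cR1]] := subset_of_card R'R0 (k := r).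
  by rewrite cR' ler andbT; lia.
have cI : #|R1 :&: core| <= p.-1.
  have := cardsID core R1; have : x.+1 <= #|R1 :\: core|; last by lia.
  rewrite -cR' subset_leq_card //; apply/subsetP=> v vR'.
  rewrite inE (subsetP R'1) // andbT.
  by have := subsetP R'R v vR'; rewrite inE => /andP[].
move/negP: free; apply.
have -> : t = t.-1.+1 by lia.
apply: (packingS (R := R1)).
- by rewrite /kclique (cliqueS R1R clR) cR1 eqxx.
- by rewrite -setI_eq0 setI0.
rewrite setU0; apply: (@packing_extend _ _ kernels r p x M) => //.
- by move=> A; rewrite inE => /andP[].
- by rewrite cR1; nia.
apply: (@packing_cover _ _ p t.-1 [:: core]) => // [A R2|A|].
- rewrite inE => /eqP -> R2Q cR2.
  have [|B BF RB] := @sub_kernel R2 R2Q; first by rewrite cR2; nia.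
  by rewrite cR2 eqxx; apply/exists_inP; exists B.
- rewrite inE => /eqP ->; have := cardsID R1 core; rewrite setIC.
  by have := card_core_eq; nia.
rewrite big_seq1; have := cardsID R1 core; rewrite setIC.
by have := card_core_eq; nia.
Qed.

(** * Far vertices and their replacement by twins *)

Local Notation V1 := (common_nbrs core).
Definition far := ~: (core :|: V1).

(** A far vertex misses a core vertex, which lies in a kernel [A]; so it is outside
    [A :|: common_nbrs A], whose complement is small. *)
Lemma card_far : #|far| <= c * nbrs_defect.
Proof.
apply: (@leq_trans #|\bigcup_(A in kernels) ~: (A :|: common_nbrs A)|).
  apply: subset_leq_card; apply/subsetP=> v.
  rewrite !inE negb_or => /andP[vQ]; rewrite vQ /=.
  rewrite negb_forall_in => /exists_inP[u /bigcupP[A AF uA] nuv].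
  apply/bigcupP; exists A => //; rewrite !inE negb_or.
  rewrite (contra _ vQ); last by move=> vA; apply/bigcupP; exists A.
  by rewrite negb_and negb_forall_in; apply/orP; right; apply/exists_inP;
    exists u.
rewrite -kernels_full; apply: leq_trans (card_bigcup_le (d := nbrs_defect) _) _.
  move=> A AF; have := card_common_nbrs AF.
  have := cardsC (A :|: common_nbrs A).
  have := subset_leq_card (subsetUr A (common_nbrs A)); lia.
by rewrite leq_mul2r subset_leq_card ?orbT //; apply/subsetP=> A; rewrite inE.
Qed.

(** One kernel already has a degree this large, and its common neighbourhood exceeds [V1] by core
    and far vertices only. *)
Lemma many_cliques_nbrs : N * D <= x ^ x * #|cliques_in x V1|
  + nbrs_clique_defect * D.
Proof.
have [A AF] : exists A, A \in kernels.
  by apply/card_gt0P; rewrite kernels_full c_gt0.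
apply: leq_trans (deg_lower AF) _;
  rewrite /nbrs_clique_defect mulnDl addnA leq_add2r.
rewrite -mulnA -mulnDr leq_mul2l; apply/orP; right.
apply: deg_split => //; apply: (@leq_trans #|core :|: far|).
  apply: subset_leq_card; apply/subsetP=> v;
    rewrite !in_setU !in_setC in_setD in_setU.
  by case: (v \in core); case: (v \in V1).
apply: leq_trans (leq_card_setU _ _).1 _.
by rewrite card_core_eq leq_add2l card_far.
Qed.

Lemma trisect E : [/\ E :\: core = (E :&: far) :|: (E :&: V1),
  #|E| = #|E :&: core| + (#|E :&: far| + #|E :&: V1|) &
  E = (E :&: core) :|: ((E :&: far) :|: (E :&: V1))].
Proof.
have dis := common_nbrs_disjoint core.
have ED : E :\: core = (E :&: far) :|: (E :&: V1).
  apply/setP=> v; rewrite in_setD in_setU !in_setI in_setC in_setU.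
  have [vQ|vQ] := boolP (v \in core); last by case: (v \in V1); case: (v \in E).
  case: (boolP (v \in V1)) => [vV|_]; last by rewrite !andbF.
  by move/disjointsP: dis => /(_ _ vV vQ).
split=> //; last by rewrite -ED setID.
rewrite -(cardsID core E) ED cardsU.
have -> : E :&: far :&: (E :&: V1) = set0.
  apply/setP=> v; rewrite !in_setI in_setC in_setU in_set0.
  by case: (v \in V1); rewrite ?orbT ?andbF.
by rewrite cards0 subn0.
Qed.

(** The binomial counts the ways to choose the remaining vertices in the core; [link_sum u] is the
    analogue for cliques through [u], the contribution of one twin of [u]. *)
Definition near_sum :=
  \sum_(B : {set V} | clique e B && (B \subset V1)) 'C(q, s - #|B|).

Definition link_sum u :=
  \sum_(B : {set V} | [&& clique e (u |: B), B \subset V1 & u \notin B])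
     'C(q, s - #|B|.+1).

Lemma card_no_far : #|[set E in kcliques s | E :&: far == set0]| <= near_sum.
Proof.
rewrite /near_sum -card_core_eq.
apply: (@card_fiber_draws _ _ V1 core core) => [E|E E']; rewrite !inE.
  case/andP=> /andP[clE /eqP cE] /eqP E0.
  rewrite (cliqueS (subsetIl _ _) clE) !subsetIr; split=> //.
  by have [_ + _] := trisect E; rewrite E0 cards0 cE; lia.
case/andP=> _ /eqP E0 /andP[_ /eqP E0'] eq1 eq2.
have [_ _ ->] := trisect E; have [_ _ ->] := trisect E'.
by rewrite E0 E0' eq1 eq2.
Qed.

Definition far_cliques w := [set E in kcliques s | E :&: far == [set w]].

(* [w] misses a vertex of the core, so that ['C(q.-1, j)] replaces ['C(q, j)]
   for some [j >= a]: a loss by the factor [q.-1 / q]. *)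
Lemma card_one_far w : w \in far ->
  q * #|far_cliques w| <= q.-1 * link_sum w.
Proof.
move=> wW; have := wW; rewrite !inE negb_or => /andP[wQ]; rewrite wQ /=.
rewrite negb_forall_in => /exists_inP[u uQ nuw].
have wV1 : w \notin V1 by move: wW; rewrite in_setC in_setU negb_or => /andP[].
have cQu : #|core :\ u| = q.-1 by have := cardsD1 u core;
  rewrite uQ card_core_eq; lia.
have le : #|far_cliques w| <= \sum_(B : {set V} | [&& clique e (w |: B),
    B \subset V1 & #|B| < x]) 'C(q.-1, s - #|B|.+1).
  rewrite -cQu.
  apply: (@card_fiber_draws _ _ V1 core (core :\ u)) => [E|E E']; rewrite !inE.
    case/andP=> /andP[clE /eqP cE] /eqP Ew.
    have wE : w \in E.
      by move: (set11 w); rewrite -Ew in_setI => /andP[].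
    have [E1 E2 _] := trisect E; rewrite Ew cards1 cE in E1 E2.
    have := @clique_outside_core E clE; rewrite cE E1 cardsU1.
    have -> : w \notin E :&: V1 by rewrite in_setI (negPf wV1) andbF.
    move=> /(_ _) => outside; split.
    - rewrite subsetIr /= outside ?andbT; last by have := x0; nia.
      apply: cliqueS clE; rewrite subUset sub1set wE; exact: subsetIl.
    - apply/subsetP=> v; rewrite in_setI in_setD1 => /andP[vE vQ];
      rewrite vQ andbT.
      apply: contraNneq nuw => <-; move/cliqueP: clE; apply=> //.
      by apply: contraNneq wQ => <-.
    by lia.
  case/andP=> _ /eqP E0 /andP[_ /eqP E0'] eq1 eq2.
  have [_ _ ->] := trisect E; have [_ _ ->] := trisect E'.
  by rewrite E0 E0' eq1 eq2.
(* For [j = s - #|B|.+1] one has [q * 'C(q.-1, j) = (q - j) * 'C(q, j)], and [#|B| < x] gives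
   [j >= a > 0]. *)
apply: leq_trans (leq_mul (leqnn q) le) _; rewrite /link_sum !big_distrr /=.
rewrite big_mkcond [leqRHS]big_mkcond; apply: leq_sum => B _.
case: ifP => // /and3P[-> BV1 ltB].
rewrite BV1 (contra (subsetP BV1 w)) //= mul_bin_down.
by rewrite leq_mul2r; apply/orP; right; have := a_gt0; lia.
Qed.

(** Fix two far vertices and the trace on the core, one of [2 ^ q]; at most [x - 2] further vertices
    remain, by [clique_outside_core]. For [x <= 1] there are no such cliques. *)
Lemma card_two_far :
  N * #|[set E in kcliques s | 1 < #|E :&: far|]| <= #|far| * (#|far| * (2 ^ q *
    D)).
Proof.
set H := [set E in _ | _].
have outside E : E \in H -> [/\ #|E| = s,
  1 < #|E :&: far| & #|E :\: core| <= x].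
  rewrite !inE => /andP[/andP[clE /eqP cE] ->]; split=> //.
  by apply: clique_outside_core => //; rewrite cE; nia.
have [x1|x1] := leqP x 1.
  rewrite [X in #|pred_of_set X|](_ : H = set0) ?cards0 ?muln0 //.
  apply/setP=> E; rewrite [RHS]inE; apply/negP=> /outside[_ gt le].
  by have [E1 E2 _] := trisect E; have := cardsID core E; lia.
suff leH : #|H| <= #|far| * (#|far| * (2 ^ q * N ^ x.-2)).
  apply: leq_trans (leq_mul (leqnn N) leH) _.
  have -> : D = N * N ^ x.-2 by rewrite -expnS; congr (_ ^ _); lia.
  by move: (2 ^ q) (N ^ x.-2) #|far| N => i j k l; lia.
apply: (card_meeting (Y := far)) => // [E /outside[_ gt _]|w wW].
  by rewrite -setI_eq0 -cards_eq0; lia.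
apply: (card_meeting (Y := far :\ w)) => [E|w'|]; last 1 first.
- by rewrite subset_leq_card // subsetDl.
- rewrite inE => /andP[/outside[_ gt _] wE]; rewrite -setI_eq0 -cards_eq0.
  by have := cardsD1 w (E :&: far); rewrite in_setI wE wW setIDA; lia.
rewrite in_setD1 => /andP[neq w'W].
have farQ v : v \in far -> v \notin core
  by rewrite in_setC in_setU negb_or => /andP[].
apply: (@leq_trans #|\bigcup_(S in powerset core)
    [set E in H | (w |: (w' |: S) \subset E) && (E :&: core == S)]|).
  apply: subset_leq_card; apply/subsetP=> E;
    rewrite !inE => /andP[/andP[EH wE] w'E].
  apply/bigcupP; exists (E :&: core); first by rewrite inE subsetIr.
  by rewrite in_set !inE EH !subUset !sub1set wE w'E subsetIl eqxx.
apply: leq_trans (card_bigcup_le (d := N ^ x.-2) _) _ => [S|].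
  rewrite inE => SQ.
  have cK : #|w |: (w' |: S)| = #|S|.+2.
    rewrite !cardsU1 !inE eq_sym (negPf neq) /=.
    by rewrite !(contra (subsetP SQ _)) ?farQ.
  have -> : x.-2 = #|S| + x - #|w |: (w' |: S)| by rewrite cK; lia.
  apply: card_supersets => [|E]; first by rewrite cK; lia.
  rewrite in_set => /and3P[/outside[_ _ le] -> /eqP ES]; split=> //.
  by rewrite -(cardsID core E) ES leq_add2l.
by rewrite leq_mul2r -{1}card_core_eq -card_powerset; apply/orP; right;
  apply: subset_leq_card; apply/subsetP=> S; rewrite inE.
Qed.

(** An [x.+1]-clique of [u |: V1] together with [p.-1] vertices of [J] would be an [r]-clique with
    more than [x] vertices outside the core. *)
Lemma no_large_clique u (J : {set V}) : u \notin core -> J \subset core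
  -> clique e J ->
  (forall v, v \in J -> e v u) -> p.-1 <= #|J| ->
  cliques_in x.+1 (u |: V1) = set0.
Proof.
move=> uQ JQ clJ Ju leJ; apply/setP=> B; rewrite !inE; apply/negP.
case/andP=> /andP[clB /eqP cB] BV.
have [||J' [_ J'J cJ']] := @subset_of_card _ set0 J p.-1.
- exact: sub0set.
- by rewrite cards0.
have BQ v : v \in B -> v \notin core.
  move/(subsetP BV); rewrite inE => /orP[|vV]; first by rewrite inE => /eqP ->.
  by apply/negP; move/disjointsP: (common_nbrs_disjoint core); apply.
have clR : clique e (J' :|: B).
  apply: cliqueU => //; first exact: cliqueS clJ.
  move=> v w vJ /(subsetP BV); rewrite inE => /orP[|].
    by rewrite inE => /eqP -> _; apply: Ju; apply: (subsetP J'J).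
  rewrite inE => /andP[_ /forall_inP h] _; apply: h.
  by apply: (subsetP JQ); apply: (subsetP J'J).
have dJB : [disjoint J' & B].
  apply/disjointsP=> v vJ /BQ /negP; apply.
  by apply: (subsetP JQ); apply: (subsetP J'J).
have cR : #|J' :|: B| = r by rewrite cardsU (disjoint_setI0 dJB) cards0 cJ' cB;
  lia.
have := clique_outside_core clR; rewrite cR leqnn => /(_ isT).
have : #|B| <= #|(J' :|: B) :\: core|; last by lia.
apply: subset_leq_card; apply/subsetP=> v vB.
by rewrite !inE vB orbT BQ.
Qed.

(* The extra weight of [u] replaces all far vertices by twins of [u]. *)
Lemma link_sum_zykov u : u \notin core -> cliques_in x.+1 (u |: V1) = set0 ->
  near_sum + #|far| * link_sum u <= optimum.
Proof.
move=> uQ noK; pose y v := (v \in V1) + #|far| * (v == u).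
have sy : \sum_v y v = #|V| - q.
  rewrite big_split /= -big_distrr /= -card_core_eq.
  have -> : \sum_v (v == u) = 1.
    by rewrite (bigD1 u) //= eqxx big1 // => v /negPf ->.
  have -> : \sum_v (v \in V1) = #|V1| by rewrite -sum1_card [RHS]big_mkcond.
  have := cardsC (core :|: V1); rewrite -/far cardsU setIC.
  rewrite (disjoint_setI0 (common_nbrs_disjoint core)) cards0 subn0 => <-.
  by rewrite muln1 -addnA addKn.
rewrite -sy; apply: leq_trans (@zykov _ e x (fun i => 'C(q, s - i)) y _);
  last first.
  move=> B clB cB; have : B \notin cliques_in x.+1 (u |: V1) by rewrite noK inE.
  rewrite inE /kclique clB cB eqxx /= => /subsetPn[v vB].
  rewrite in_setU1 negb_or => /andP[/negPf vu /negPf vV].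
  by exists v; rewrite // /y vu vV muln0.
rewrite (wsum_split1 _ _ u) /near_sum /link_sum.
rewrite big_mkcond (big_setU1_split u) /= [X in _ + _ * X]big_mkcond.
rewrite [X in _ + X](_ : _ = \sum_(B : {set V} | u \notin B)
   #|far| * (if clique e (u |: B) && (B \subset V1) then 'C(q,
     s - #|B|.+1) else 0)).
  rewrite -big_split /=; apply: leq_sum => B uB.
  have yB : \prod_(v in B) y v = (B \subset V1).
    have [/subsetP BV|/subsetPn[v vB /negPf vV]] := boolP (B \subset V1).
      rewrite big1 // => v vB; rewrite /y (BV _ vB).
      by rewrite (_ : v == u = false) ?muln0 //; apply: contraNF uB => /eqP <-.
    rewrite (bigD1 v) //= /y vV (_ : v == u = false) ?muln0 //.
    by apply: contraNF uB => /eqP <-.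
  rewrite yB subUset sub1set cardsU1 uB add1n {1}/y eqxx muln1.
  case: (B \subset V1); rewrite ?andbF ?muln0 //= !andbT mul1n.
  (* For [u] in [V1] the weight is [1 + #|far|], and the unit accounts for the cliques of [near_sum]
     through [u]. *)
  by case: (clique e B); case: (clique e _); case: (u \in V1); rewrite /=; lia.
rewrite -big_distrr /= [in RHS]big_mkcond /=; congr (_ * _);
  apply: eq_bigr => B _.
by case: (u \in B); rewrite ?andbF ?andbT.
Qed.

(** Without [u] such a clique has [x.-1] vertices, so its coefficient in [link_sum u] is ['C(q, a)],
    which is positive. *)
Lemma card_cliques_in_link u :
  #|[set B in cliques_in x V1 | u \in B]| <= link_sum u.
Proof.
have inj : {in [set B in cliques_in x V1 | u \in B] &,
    injective (fun B : {set V} => B :\ u)}.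
  move=> B B'; rewrite !inE => /andP[_ uB] /andP[_ uB'] E.
  by rewrite -(setD1K uB) -(setD1K uB') E.
rewrite -(card_in_imset inj) -sum1_card /link_sum big_mkcond [leqRHS]big_mkcond
  /=.
apply: leq_sum => B' _; case: ifP => // /imsetP[B + ->].
rewrite !inE => /andP[/andP[/andP[clB /eqP cB] BV] uB].
rewrite setD1K // clB eqxx /= (subset_trans (subsetDl _ _)) //=.
have -> : s - #|B :\ u|.+1 = a by have := cardsD1 u B; rewrite uB; lia.
exact: c_gt0.
Qed.

Definition order_bound := x ^ x * (q * (c * nbrs_defect) * 2 ^ q)
  + nbrs_clique_defect.

Lemma not_large : N <= order_bound.
Proof.
rewrite leqNgt; apply/negP=> lt8.
have V1_gt0 : 0 < #|V1|.
  rewrite lt0n; apply/eqP=> V0; have := many_cliques_nbrs.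
  have -> : #|cliques_in x V1| = 0.
    apply/eqP; rewrite cards_eq0; apply/eqP/setP=> B; rewrite !inE.
    rewrite (cards0_eq V0) subset0; apply/negP=> /andP[/andP[_ cB] /eqP B0].
    by move: cB; rewrite B0 cards0; lia.
  rewrite muln0 leq_mul2r expn_eq0 /= => leN.
  by have := leq_ltn_trans (leq_addl _ _) lt8; rewrite ltnNge leN.
(* The candidates for [u] are vertices whose addition keeps [V1] free of [x.+1]-cliques. Far
   vertices with empty [far_cliques] contribute nothing and are left out. *)
pose P u := (u \in V1) || ((u \in far) && (far_cliques u != set0)).
have [v0 v0V] : exists v, v \in V1 by apply/card_gt0P.
have Pv0 : P v0 by rewrite /P v0V.
pose u := [arg max_(v > v0 | P v) link_sum v].
have [Pu maxu] : P u /\ forall v, P v -> link_sum v <= link_sum u.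
  by rewrite /u; case: arg_maxnP => // i Pi le; split.
have farQ v : v \in far -> v \notin core.
  by rewrite in_setC in_setU negb_or => /andP[].
have noK : cliques_in x.+1 (u |: V1) = set0.
  case/orP: Pu => [uV|/andP[uW /set0Pn[E]]].
    have [|A AF _] := @sub_kernel set0 (sub0set _); first by rewrite cards0.
    have AQ : A \subset core by apply: bigcup_sup.
    apply: (@no_large_clique u A) => //.
    - by apply/negP; move/disjointsP: (common_nbrs_disjoint core); apply.
    - exact: kernels_clique.
    - move=> v vA; move: uV; rewrite inE => /andP[_ /forall_inP h].
      by apply: h; apply: (subsetP AQ).
    by rewrite (card_kernel AF); nia.
  rewrite !inE => /andP[/andP[clE /eqP cE] /eqP Eu].
  have uE : u \in E by move: (set11 u); rewrite -Eu in_setI => /andP[].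
  apply: (@no_large_clique u (E :&: core)) => //.
  - exact: farQ.
  - exact: subsetIr.
  - by apply: cliqueS clE; apply: subsetIl.
  - move=> v; rewrite in_setI => /andP[vE vQ]; move/cliqueP: clE; apply=> //.
    by apply: contraNneq (farQ _ uW) => <-.
  have := clique_outside_core clE; rewrite cE => /(_ _) out.
  by have := cardsID core E; rewrite cE; have := out; nia.
have uQ : u \notin core.
  case/orP: Pu => [uV|/andP[/farQ]] //.
  by apply/negP; move/disjointsP: (common_nbrs_disjoint core); apply.
have le0 := link_sum_zykov uQ noK.
have le1 w : w \in far -> q * #|far_cliques w| <= q.-1 * link_sum u.
  move=> wW; have [->|ne] := eqVneq (far_cliques w) set0.
    by rewrite cards0 muln0.
  apply: leq_trans (card_one_far wW) _; rewrite leq_mul2l maxu ?orbT //.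
  by rewrite /P wW ne orbT.
have le2 : #|kcliques s| <= near_sum + \sum_(w in far) #|far_cliques w| +
    #|[set E in kcliques s | 1 < #|E :&: far|]|.
  apply: leq_trans (_ : #|[set E in kcliques s | E :&: far == set0] :|:
     \bigcup_(w in far) far_cliques w :|: [set E in kcliques s | 1 < #|E :&:
       far|]| <= _).
    apply: subset_leq_card; apply/subsetP=> E Es; rewrite !in_setU.
    have [gt|ge] := ltnP 1 #|E :&: far|.
      by apply/orP; right; rewrite in_set Es.
    apply/orP; left; apply/orP.
    have [E0|[w wEW]] := set_0Vmem (E :&: far); first by left;
      rewrite in_set Es E0 /=.
    right; apply/bigcupP; exists w; first by move: wEW;
      rewrite in_setI => /andP[].
    by rewrite in_set Es /= eq_sym eqEcard sub1set wEW cards1.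
  apply: leq_trans (leq_card_setU _ _).1 _; rewrite leq_add2r.
  apply: leq_trans (leq_card_setU _ _).1 _; apply: leq_add;
    first exact: card_no_far.
  exact: card_bigcup_sum.
have le3 : q * \sum_(w in far) #|far_cliques w| <= #|far| * (q.-1 * link_sum u).
  by rewrite big_distrr /= -sum_nat_const; apply: leq_sum.
have le4 := card_two_far.
have le5 : #|cliques_in x V1| <= N * link_sum u.
  apply: leq_trans (_ : #|V1| * link_sum u <= _); last first.
    by rewrite leq_mul2r ltnW ?orbT // ltnS max_card.
  apply: (card_meeting (Y := V1)) => // [B|v vV].
    rewrite !inE => /andP[/andP[_ /eqP cB] BV].
    by rewrite -setI_eq0 (setIidPl BV) -cards_eq0 cB -lt0n.
  by apply: leq_trans (card_cliques_in_link _) _; apply: maxu; rewrite /P vV.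
have le6 := many_cliques_nbrs.
have le7 := card_far.
have q0 : 0 < q by have := a_gt0; have := a_leq_q; lia.
have D0 : 0 < D by rewrite expn_gt0.
move: many lt8 le0 le2 le3 le4 le5 le6 le7; rewrite /order_bound.
move: (turan_sum _ _ _) near_sum (link_sum u) (\sum_(w in far) _) #|far|.
move: #|cliques_in x V1| #|kcliques s| #|[set E in kcliques s | _]| (c *
  nbrs_defect) nbrs_clique_defect.
move: (x ^ x) (2 ^ q) D0; move: D; move: N q q0; clear.
move=> N q q0 D y z D0 k K h f c7 O T L S W.
move=> lt lt8 le0 le2 le3 le4 le5 le6 le7.
(* Of the [W * L] cliques through the twins, at least the fraction [1 / q] is lost by the far
   vertices; only the [h] cliques with two far vertices can make up for it. *)
have h1 : W * L < q * h by case: q q0 {lt8} le3 => // q _ /= le3; nia.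
have h2 : W * (N * L) < W * (q * W * (z * D)).
  have : N * (W * L) < N * (q * h) by rewrite ltn_mul2l h1;
    case: N lt8 {le4 le5 le6}.
  have : q * (N * h) <= q * (W * (W * (z * D))) by rewrite leq_mul2l le4 orbT.
  nia.
(* Strictness of [h2] rules out [W = 0], so [W] cancels. *)
have h3 : N * L < q * f * z * D.
  move: h2; rewrite ltn_mul2l => /andP[_ h2]; apply: leq_trans h2 _.
  by rewrite -!mulnA leq_mul2l; apply/orP; right; rewrite leq_mul2r le7 orbT.
have h4 : y * k <= y * (q * f * z * D).
  by rewrite leq_mul2l; apply/orP; right; apply: leq_trans le5 (ltnW h3).
have : N * D <= (y * (q * f * z) + c7) * D by rewrite mulnDl -mulnA;
  apply: leq_trans le6 _; rewrite leq_add2r.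
by rewrite leq_mul2r => /orP[/eqP E|]; [rewrite E in D0 | rewrite leqNgt lt8].
Qed.

End Structure.

Lemma kcliques_upper x p a t : 0 < p -> 1 < t -> t * p.-1 < a -> a < t * p ->
  exists n0, forall (V : finType) (e : rel V), symmetric e -> n0 <= #|V| ->
    ~~ packing (kclique e (p + x)) t set0 ->
    #|kcliques e (a + x)| <=
    turan_sum x (fun i => 'C((t * p).-1, a + x - i)) (#|V| - (t * p).-1).
Proof.
move=> p0 t2 lo hi; have [->|x0] := posnP x.
  (* For [x = 0] the [a]-cliques themselves play the role of the kernels. *)
  exists 0 => V e e_sym _; rewrite !addn0 => free.
  have leU : #|\bigcup_(A in kcliques e a) A| <= (t * p).-1.
    rewrite leqNgt; apply/negP=> lt; move/negP: free; apply.
    apply: (@packing_cover _ _ p t (enum (kcliques e a))) => // [A R|A|].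
    - rewrite mem_enum inE => /andP[clA _] RA cR.
      by rewrite /kclique (cliqueS RA clA) cR eqxx.
    - by rewrite mem_enum inE setD0 => /andP[_ /eqP ->].
    by rewrite setD0 big_enum /=; apply: leq_trans (leqSpred _) lt.
  apply: (@leq_trans 'C((t * p).-1, a)); last first.
    rewrite /turan_sum /wsum (bigD1 set0) //= cards0 subn0 big_set0 muln1.
    exact: leq_addr.
  apply: leq_trans (leq_bin2l _ leU); rewrite -cards_draws.
  apply: subset_leq_card; apply/subsetP=> A AK; rewrite inE.
  by rewrite (bigcup_sup _ AK) /=; move: AK; rewrite inE => /andP[].
exists (order_bound x p a t) => V e e_sym large free; rewrite leqNgt;
  apply/negP=> many.
have le : kernel_defect x p a t <= order_bound x p a t.
  by rewrite /order_bound /nbrs_clique_defect addnA leq_addl.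
have := not_large e_sym p0 t2 lo hi x0 free many; rewrite ltnS.
move=> /(_ (leq_trans le large)); by rewrite leqNgt ltnS large.
Qed.

(** * From graphs and copies to cliques and packings *)

Section Adjacency.
Variables (T : finType).
Implicit Types (G : graph T) (e : rel T).

Lemma set2_inj (u v a b : T) : [set u; v] = [set a; b] ->
  (u = a /\ v = b) \/ (u = b /\ v = a).
Proof.
move=> E; have := set21 u v; have := set22 u v; have := set21 a b;
  have := set22 a b.
rewrite {1 2}E -{1 2}E !inE.
by do 4!case/orP=> /eqP ?; subst; auto.
Qed.

Lemma adj_sym G : symmetric (adj G).
Proof. by move=> u v; rewrite /adj setUC. Qed.

Lemma adj_neq G u v : adj G u v -> u != v.
Proof.
move=> uv; have /forall_inP/(_ _ uv) := valP G.
by rewrite cards2; case: (u != v).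
Qed.

Lemma adj_graph_of_rel e u v :
  adj (graph_of_rel e) u v = (u != v) && (e u v || e v u).
Proof.
rewrite /adj inE cards2; case: (u != v) => //=; rewrite ?andbF //.
apply/existsP/orP=> [[a /existsP[b /andP[eab /eqP]]]|].
  by case/set2_inj=> [][-> ->]; [left|right].
case=> h; [exists u; apply/existsP; exists v|exists v; apply/existsP; exists u].
  by rewrite h eqxx.
by rewrite h setUC eqxx.
Qed.

End Adjacency.

Lemma adj_complete n u v : adj (complete_graph n) u v = (u != v).
Proof. by rewrite /complete_graph adj_graph_of_rel (eq_sym v) orbb andbb. Qed.

Section Copies.
Variable T : finType.
Implicit Type G : graph T.

Definition pairs_in (A : {set T}) := [set B : {set T} | (B \subset A)
  && (#|B| == 2)].

(** A copy of a complete graph is determined by its vertex set, its edges being all pairs inside. *)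
Lemma ncopies_complete s G : ncopies (complete_graph s) G = #|kcliques (adj G)
  s|.
Proof.
have inj : injective (fun A : {set T} => (A, pairs_in A)) by move=> A B [].
rewrite /ncopies -(card_imset _ inj); congr #|pred_of_set _|.
apply/setP=> -[A D]; apply/idP/imsetP => [|[A' + [-> ->]]]; rewrite !inE /=.
  case/andP=> /andP[/= /subsetP DG /forall_inP DA] /existsP[f].
  case/and3P=> /injectiveP finj /eqP /= fA /'forall_forallP /= h.
  have AP u : reflect (exists i, u = f i) (u \in A).
    rewrite -fA; apply: (iffP imsetP) => [[i _ ->]|[i ->]]; by exists i;
      rewrite ?inE.
  have fD i j : i != j -> [set f i; f j] \in D.
    by move=> ij; rewrite -(eqP (h i j)) adj_complete.
  exists A; last congr (_, _).
    rewrite inE /kclique -fA card_imset // cardsT card_ord eqxx andbT fA.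
    apply/cliqueP=> _ _ /AP[i ->] /AP[j ->] ne; apply: DG; apply: fD.
    by apply: contraNneq ne => ->.
  apply/setP=> B; rewrite [RHS]inE; apply/idP/idP => [BD|].
    by rewrite (DA _ BD) (forall_inP (valP G) _ (DG _ BD)).
  case/andP=> BA /cards2P[u [v [ne EB]]].
  move: BA; rewrite EB subUset !sub1set => /andP[/AP[i Ei] /AP[j Ej]].
  by rewrite Ei Ej; apply: fD; apply: contraNneq ne => E; rewrite Ei Ej E.
case/andP=> /cliqueP clA /eqP cA; apply/andP; split.
  apply/andP; split=> /=; last by apply/forall_inP=> B; rewrite inE => /andP[].
  apply/subsetP=> B; rewrite inE => /andP[BA /cards2P[u [v [ne EB]]]].
  by move: BA; rewrite EB subUset !sub1set => /andP[uA vA]; apply: clA.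
pose f := [ffun i : 'I_s => enum_val (cast_ord (esym cA) i)].
have finj : injective f.
  by move=> i j; rewrite !ffunE => /enum_val_inj/cast_ord_inj.
have fA i : f i \in A' by rewrite ffunE; apply: enum_valP.
apply/existsP; exists f; apply/and3P; split.
- exact/injectiveP.
- rewrite eqEcard card_imset // cardsT card_ord cA leqnn andbT.
  by apply/subsetP=> _ /imsetP[i _ ->]; apply: fA.
apply/'forall_forallP=> i j; apply/eqP; rewrite adj_complete inE cards2.
by rewrite subUset !sub1set !fA (inj_eq finj); case: eqP.
Qed.

(** The row of [i] in ['I_t * 'I_r] corresponds to the [i]-th clique of a packing. *)
Lemma is_free_packing t r G :
  is_free (disjoint_copies t (complete_graph r)) G =
  ~~ packing (kclique (adj G) r) t set0.
Proof.
have adjK i j i' j' : adj (disjoint_copies t (complete_graph r)) (i, j) (i',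
  j') =
    (i == i') && (j != j').
  rewrite /disjoint_copies adj_graph_of_rel /= !adj_complete xpair_eqE.
  rewrite !(eq_sym i') !(eq_sym j') !orbb.
  by case: (i == i'); case: (j == j').
rewrite /is_free -[LHS]negbK; congr (~~ _); apply/set0Pn/packing_seqP.
  case=> -[A D]; rewrite inE => /andP[/andP[/= /subsetP DG _] /existsP[f]].
  case/and3P=> /injectiveP finj _ /'forall_forallP /= h.
  exists [seq [set f (i, j) | j : 'I_r] | i <- enum 'I_t]; split.
  - by rewrite size_map size_enum_ord.
  - apply/allP=> _ /mapP[i _ ->]; rewrite /kclique card_imset; last first.
      by move=> j j' /finj[].
    rewrite card_ord eqxx andbT;
      apply/cliqueP=> _ _ /imsetP[j _ ->] /imsetP[j' _ ->] ne.
    apply: DG; rewrite -(eqP (h _ _)) adjK eqxx /=.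
    by apply: contraNneq ne => ->.
  - rewrite pairwise_map; have := enum_uniq 'I_t; rewrite uniq_pairwise.
    apply: sub_pairwise => i i' /= ne; apply/disjointsP=> _ /imsetP[j _ ->].
    by case/imsetP=> j' _ /finj[E _]; rewrite E eqxx in ne.
  by apply/allP=> A' _; rewrite -setI_eq0 setI0.
case=> L [sL /allP LP pL _].
have LiP (i : 'I_t) : nth set0 L i \in L by rewrite mem_nth ?sL.
have cL (i : 'I_t) : #|nth set0 L i| = r by have /andP[_ /eqP] := LP _ (LiP i).
pose f := [ffun ij : 'I_t * 'I_r => enum_val (cast_ord (esym (cL ij.1)) ij.2)].
have fL i j : f (i, j) \in nth set0 L i by rewrite ffunE; apply: enum_valP.
have uL (i i' : 'I_t) v : v \in nth set0 L i -> v \in nth set0 L i' -> i = i'.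
  move=> vi vi'; apply/eqP; rewrite -val_eqE /=; apply: contraT => ne.
  have dis (k k' : 'I_t) : k < k' -> [disjoint nth set0 L k & nth set0 L k'].
    by move=> lt; apply: (pairwiseP set0 pL); rewrite ?inE ?sL.
  by case: ltngtP ne => // /dis /disjointsP h _; case: (h v).
have finj : injective f.
  move=> [i j] [i' j'] E; have Ei : i = i' by apply: (uL _ _ (f (i, j)));
    rewrite // E.
  subst i'; congr (_, _); move: E; rewrite !ffunE.
  by move/enum_val_inj/cast_ord_inj.
exists (f @: [set: 'I_t * 'I_r],
  [set B : {set T} | [exists i : 'I_t, B \subset nth set0 L i] && (#|B| == 2)]).
rewrite inE; apply/andP; split.
  apply/andP; split=> /=.
    apply/subsetP=> B; rewrite inE =>
      /andP[/existsP[i BL] /cards2P[u [v [ne EB]]]].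
    move: BL; rewrite EB subUset !sub1set => /andP[ui vi].
    by have /andP[/cliqueP cl _] := LP _ (LiP i); apply: cl.
  apply/forall_inP=> B; rewrite inE => /andP[/existsP[i BL] _].
  apply: subset_trans BL _; apply/subsetP=> v vi; apply/imsetP.
  exists (i, cast_ord (cL i) (enum_rank_in vi v)); first by rewrite inE.
  by rewrite ffunE /= cast_ordK enum_rankK_in.
apply/existsP; exists f; apply/and3P; split; [exact/injectiveP|exact: eqxx|].
apply/'forall_forallP=> -[i j] [i' j']; apply/eqP;
  rewrite adjK inE cards2 (inj_eq finj).
rewrite xpair_eqE; apply/andP/andP=> [[/eqP <- ne]|[/existsP[k]]].
  rewrite eqxx /= ne; split=> //; apply/existsP; exists i.
  by rewrite subUset !sub1set !fL.
rewrite subUset !sub1set => /andP[/(uL _ _ _ (fL i j)) <- /(uL _ _ _ (fL i' j'))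
  <-].
by rewrite eqxx /=; case: (j == j').
Qed.

End Copies.

(** * The extremal graph *)

Lemma packing_capacity (V : finType) (P : pred {set V}) k p (Q Z : {set V}) :
  (forall R, P R -> p <= #|R :&: Q|) -> packing P k Z -> k * p
    + #|Z :&: Q| <= #|Q|.
Proof.
move=> PQ; elim: k Z => [|k IH] Z.
  by rewrite add0n => _; rewrite subset_leq_card // subsetIr.
case/existsP=> R /and3P[/PQ le dRZ /IH]; apply: leq_trans.
rewrite mulSn setIUl cardsU.
have -> : R :&: Q :&: (Z :&: Q) = set0.
  by rewrite setIACA (disjoint_setI0 dRZ) set0I.
by rewrite cards0; lia.
Qed.

Section Extremal.
Variables (q m x : nat).

Local Notation part := {i : 'I_x & 'I_(turan_part m i)}.
Local Notation vertex := ('I_q + part)%type.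
Local Notation G0 := (join (complete_graph q) (turan m x)).

Lemma adj_extremal (u v : vertex) : adj G0 u v =
  match u, v with
  | inl i, inl j => i != j
  | inr i, inr j => tag i != tag j
  | _, _ => true
  end.
Proof.
rewrite /join adj_graph_of_rel; case: u v => [i|i] [j|j] //=.
  rewrite !adj_complete (eq_sym j) !orbb; case: (i =P j) => [->|ne];
    first by rewrite !andbF.
  by rewrite andbT; case: eqP => // -[].
rewrite /turan !adj_graph_of_rel (eq_sym j) (eq_sym (tag j)) !orbb.
have [E|ne] := eqVneq (tag i) (tag j); first by rewrite !andbF.
have ne1 : i != j by apply: contraNneq ne => ->.
by rewrite ne1.
Qed.

Let core0 := [set inl u | u : 'I_q] : {set vertex}.

Lemma extremal_outside_core R : clique (adj G0) R -> #|R :\: core0| <= x.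
Proof.
move=> /cliqueP clR; pose g (v : vertex) := if v is inr p then Some (tag p) else
  None.
have out v : v \in R :\: core0 -> exists2 p, v = inr p & v \in R.
  rewrite inE; case: v => [i|p] /andP[h vR]; last by exists p.
  by case/negP: h; apply: imset_f.
have ginj : {in R :\: core0 &, injective g}.
  move=> u v /out[i -> iR] /out[j -> jR] [E]; apply/eqP; apply: contraT => ne.
  by have := clR _ _ iR jR ne; rewrite adj_extremal E eqxx.
rewrite -(card_in_imset ginj) -[leqRHS]card_ord.
have <- : #|[set~ (None : option 'I_x)]| = #|'I_x|
  by rewrite cardsC1 card_option.
apply: subset_leq_card; apply/subsetP=> _ /imsetP[v /out[i -> _] ->].
by rewrite !inE.
Qed.

(** A clique has at most one vertex in each of the [x] parts, so each of the [t] cliques would need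
    [p] of the [q] core vertices. *)
Lemma extremal_free p t : q < t * p ->
  ~~ packing (kclique (adj G0) (p + x)) t set0.
Proof.
move=> lt; apply/negP=> /(@packing_capacity _ _ _ p core0).
rewrite set0I cards0 addn0 card_imset; last by move=> u v [].
rewrite card_ord => /(_ _); rewrite leqNgt lt => h; apply: notF; apply: h.
move=> R /andP[clR /eqP cR]; have := extremal_outside_core clR.
by move=> out; rewrite -(leq_add2r x) -cR -(cardsID core0 R) leq_add2l.
Qed.

Lemma card_extremal : #|{: vertex}| = q + (if 0 < x then m else 0).
Proof.
rewrite card_sum card_ord card_tagged; congr (_ + _).
rewrite sumnE big_map big_enum /=.
under eq_bigr do rewrite card_ord.
by case: posnP => [E|/sum_turan_part]; [case: (x) E => // _;
  rewrite big_ord0 |].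
Qed.

(** Group the cliques by the set [I] of parts they meet: one vertex from each part of [I] and any
    [s - #|I|] core vertices form such a clique. *)
Lemma extremal_lower s : x <= s ->
  turan_sum x (fun i => 'C(q, s - i)) m <= #|kcliques (adj G0) s|.
Proof.
move=> xs.
pose tags (E : {set vertex}) := [set j | [exists p : part,
  (tag p == j) && (inr p \in E)]].
rewrite -sum1_card (partition_big tags predT) //= /turan_sum /wsum.
apply: leq_sum => I _; rewrite sum1dep_card.
(* A choice of one vertex per part of [I] is a function in [pfamily], equal to [None] off [I]. *)
pose F (j : 'I_x) : pred (option part) := fun o =>
  if o is Some p then tag p == j else false.
have -> : \prod_(j in I) turan_part m j = #|[set f in pfamily None (mem I) F]|.
  rewrite cardsE card_pfamily foldrE big_map big_enum /=; apply: eq_bigr => j _.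
  pose tg k : option part := Some (Tagged (fun i : 'I_x =>
    'I_(turan_part m i)) k).
  have tinj : injective (tg j).
    by move=> k k' [] /eqP; rewrite eq_Tagged /= => /eqP.
  rewrite -[LHS]card_ord -(card_imset _ tinj); apply: eq_card => o.
  apply/imsetP/idP => [[k _ ->]|]; first by rewrite unfold_in /= eqxx.
  by rewrite unfold_in; case: o => // -[j' k] /= /eqP E; subst j'; exists k.
rewrite -[q in 'C(q, _)]card_ord -cardsT -cards_draws -cardsX.
pose B (f : {ffun 'I_x -> option part}) := [set p | f (tag p) == Some p].
pose h (Af : {set 'I_q} * {ffun 'I_x -> option part}) : {set vertex} :=
  (inl @: Af.1) :|: (inr @: B Af.2).
have inl_h Af u : (inl u \in h Af) = (u \in Af.1).
  rewrite inE mem_imset; last by move=> ? ? [].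
  by rewrite orbC; case: imsetP => // -[].
have inr_h Af p : (inr p \in h Af) = (Af.2 (tag p) == Some p).
  rewrite inE orbC mem_imset ?inE; last by move=> ? ? [].
  by rewrite orbC; case: imsetP => // -[].
have famP (f : {ffun 'I_x -> option part}) j : f \in pfamily None (mem I) F ->
    if j \in I then exists2 p, f j = Some p & tag p = j else f j = None.
  case/pfamilyP=> /subsetP supp fF; case: ifP => jI.
    by have := fF _ jI; rewrite unfold_in; case: (f j) => // p /eqP; exists p.
  by apply/eqP; apply: contraFT jI => ne; apply: supp.
rewrite -(card_in_imset (f := h)).
  apply: subset_leq_card; apply/subsetP=> _ /imsetP[[A f] + ->].
  rewrite in_setX !inE /= => /andP[/andP[_ /eqP cA] ff].
  have tagsI : [set tag p | p in B f] = I.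
    apply/setP=> j; apply/imsetP/idP => [[p + ->]|jI].
      by rewrite inE; have := famP f (tag p) ff; case: ifP => // _ ->.
    have := famP f j ff; rewrite jI => -[p fj Ep]; exists p => //.
    by rewrite inE Ep fj.
  have taginj : {in B f &, injective (fun p : part => tag p)}.
    move=> p p'; rewrite !inE => /eqP fp /eqP fp' E.
    by move: fp; rewrite E fp' => /Some_inj.
  (* This keeps [s - #|I|] from truncating. *)
  have leI : #|I| <= s by rewrite (leq_trans (max_card _)) // card_ord.
  rewrite /kclique; apply/andP; split; [apply/andP; split|].
  - apply/cliqueP=> -[u|p] [v|p'] + + ne;
    rewrite adj_extremal ?inl_h ?inr_h //=.
    move=> /eqP /= fp /eqP /= fp'; apply: contraNneq ne => E.
    by move: fp; rewrite E fp' => /Some_inj ->.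
  - rewrite cardsU !card_imset; try by move=> ? ? [].
    have -> : (inl @: A : {set vertex}) :&: inr @: B f = set0.
      apply/setP=> v; rewrite in_setI in_set0; apply/negP.
      by case/andP=> /imsetP[u _ ->] /imsetP[].
    have cB : #|B f| = #|I| by rewrite -[in RHS]tagsI (card_in_imset taginj).
    by rewrite cards0 subn0 cA cB subnK.
  apply/eqP; rewrite -[RHS]tagsI; apply/setP=> j; rewrite inE.
  apply/existsP/imsetP => [[p /andP[/eqP <-]]|[p + ->]].
    by rewrite inr_h => fp; exists p; rewrite // inE.
  by rewrite inE => fp; exists p; rewrite eqxx inr_h.
move=> [A f] [A' f']; rewrite !in_setX !inE /= => /andP[_ ff] /andP[_ ff'] E.
congr (_, _); first by apply/setP=> u; rewrite -(inl_h (A, f)) E inl_h.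
apply/ffunP=> j; have := famP f j ff; have := famP f' j ff'; case: ifP => _.
  move=> _ [p fj Ep]; have : inr p \in h (A', f') by rewrite -E inr_h /= Ep fj.
  by rewrite inr_h /= Ep fj => /eqP.
by move=> -> ->.
Qed.

End Extremal.

(** * Padding to [n] vertices, the ceiling, and the conclusion *)

Lemma embed_graph (T : finType) (G : graph T) n : #|T| <= n ->
  exists G' : graph 'I_n,
    (forall s, #|kcliques (adj G) s| <= #|kcliques (adj G') s|) /\
    (forall r t, 1 < r -> ~~ packing (kclique (adj G) r) t set0 ->
       ~~ packing (kclique (adj G') r) t set0).
Proof.
move=> le; pose h v := widen_ord le (enum_rank v).
have hinj : injective h.
  by move=> u v /(congr1 val) /= E; apply: enum_rank_inj; apply: val_inj.
(* The vertices outside the image of [h] are isolated. For [x = 0] the join has fewer than [n]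
   vertices, so padding really occurs. *)
pose G' := graph_of_rel (fun u v =>
  [exists a, exists b, [&& h a == u, h b == v & adj G a b]]).
have adjP u v : reflect (exists a b, [/\ u = h a,
  v = h b & adj G a b]) (adj G' u v).
  rewrite /G' adj_graph_of_rel; apply: (iffP andP).
    case=> _ /orP[] /existsP[a /existsP[b /and3P[/eqP <- /eqP <- ab]]].
      by exists a, b.
    by exists b, a; rewrite adj_sym.
  case=> a [b [-> -> ab]]; split; first by rewrite (inj_eq hinj) (adj_neq ab).
  apply/orP; left; apply/existsP; exists a; apply/existsP; exists b.
  by rewrite !eqxx ab.
have adjh a b : adj G' (h a) (h b) = adj G a b.
  apply/adjP/idP => [[a' [b' [/hinj -> /hinj ->]]] //|ab].
  by exists a, b.
exists G'; split=> [s|r t r1].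
  have inj : {in kcliques (adj G) s &, injective (fun A : {set T} => h @: A)}.
    by move=> A B _ _; apply: imset_inj.
  rewrite -(card_in_imset inj); apply: subset_leq_card.
  apply/subsetP=> _ /imsetP[A + ->];
    rewrite !inE => /andP[/cliqueP clA /eqP cA].
  rewrite /kclique card_imset // cA eqxx andbT.
  apply/cliqueP=> _ _ /imsetP[a aA ->] /imsetP[b bA ->] ne; rewrite adjh.
  by apply: clA => //; apply: contraNneq ne => ->.
apply: contra; rewrite -(preimset0 h).
elim: t (set0) => [//|t IH] Z /= /existsP[R /and3P[/andP[/cliqueP clR /eqP cR]
  dRZ pk]].
(* As [r > 1], every vertex of an [r]-clique has a neighbour, so it is in the image of [h]. *)
have RE : h @: (h @^-1: R) = R.
  apply/setP=> u; apply/imsetP/idP => [[a + ->]|uR]; first by rewrite inE.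
  have : 0 < #|R :\ u| by have := cardsD1 u R; rewrite uR cR add1n => E;
    rewrite -ltnS -E.
  case/card_gt0P=> v; rewrite in_setD1 => /andP[ne vR].
  have /adjP[a [b [Ea _ _]]] : adj G' u v by apply: clR; rewrite // eq_sym.
  by exists a; rewrite // inE -Ea.
apply: (packingS (R := h @^-1: R)).
- rewrite /kclique -(card_imset _ hinj) RE cR eqxx andbT.
  apply/cliqueP=> a b; rewrite !inE => aR bR ne; rewrite -adjh.
  by apply: clR; rewrite // (inj_eq hinj).
- apply/disjointsP=> a; rewrite !inE => aR aZ.
  by move/disjointsP: dRZ => /(_ _ aR aZ).
by rewrite -preimsetU; apply: IH.
Qed.

(** The quotient lies above [x] and is at most [x + 1]; multiply by its denominator, which is
    positive. *)
Lemma ceil_bounds (r t s x : nat) : 1 < t -> s < t * r ->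
  (x%:Z = Num.ceil ((t%:R * r%:R - s%:R) / (t%:R - 1) : rat) - 1)%R ->
  x * t.-1 + s < t * r <= x.+1 * t.-1 + s.
Proof.
move=> t1 st hx; have := Num.Theory.ceil_itv ((t%:R * r%:R - s%:R) / (t%:R - 1)
  : rat)%R.
rewrite -hx -[X in (_ <= X%:~R)%R](GRing.subrK 1%R) -hx.
have -> : (t%:R - 1 = t.-1%:R :> rat)%R
  by rewrite -(GRing.natrB rat (ltnW t1)) subn1.
have t0 : (0 < t.-1%:R :> rat)%R by rewrite Num.Theory.ltr0n; lia.
have -> : ((x%:Z + 1)%:~R = x.+1%:R :> rat)%R by rewrite -addn1.
rewrite Num.Theory.ltr_pdivlMr // Num.Theory.ler_pdivrMr //.
rewrite Num.Theory.ltrBrDr Num.Theory.lerBlDr -!GRing.natrM -!GRing.natrD.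
by rewrite Num.Theory.ltr_nat Num.Theory.ler_nat.
Qed.

Theorem theorem1p2 (r t s x : nat)
  (hr : 2 <= r) (ht : 1 <= t) (hs : r <= s < t * r)
  (hx : (x%:Z = Num.ceil ((t%:R * r%:R - s%:R) / (t%:R - 1) : rat) - 1)%R) :
  exists n0 : nat, forall n : nat, n0 <= n ->
    ex n (complete_graph s) (disjoint_copies t (complete_graph r)) =
    ncopies (complete_graph s)
      (join (complete_graph (t * (r - x) - 1))
            (turan (n - t * (r - x) + 1) x)).
Proof.
have /andP[rs st] := hs; have t1 : 1 < t by nia.
have /andP[lo hi] := ceil_bounds t1 st hx.
have xr : x < r by nia.
have [p Er] : exists p, r = p + x by exists (r - x); lia.
have [a Es] : exists a, s = a + x by exists (s - x); lia.
subst r s; rewrite addnK subn1.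
have p0 : 0 < p by lia.
(* With [r = p + x] and [s = a + x] the ceiling bounds become [t * p.-1 < a < t * p]. *)
have lo' : t * p.-1 < a.
  by move: lo hi t1; case: (t) => // t' /=; case: (p) p0 => // p' _ /=; nia.
have hi' : a < t * p.
  by move: lo hi t1; case: (t) => // t' /=; nia.
have [n1 upper] := kcliques_upper x p0 t1 lo' hi'.
exists (maxn n1 (t * p)) => n; rewrite geq_max => /andP[n1n tpn].
have tp0 : 0 < t * p by nia.
(* This relies on [t * p <= n], whence the maximum in the choice of the threshold. *)
have Em : n - t * p + 1 = n - (t * p).-1 by lia.
rewrite Em; set q := (t * p).-1; set G0 := join _ _.
rewrite ncopies_complete; apply/eqP; rewrite eqn_leq; apply/andP; split.
  apply/bigmax_leqP=> G; rewrite is_free_packing => free.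
  rewrite ncopies_complete.
  apply: leq_trans (extremal_lower _ _ (leq_addl a x)).
  have := upper _ _ (adj_sym G) _ free; rewrite card_ord; exact.
have [|G [ge free]] := @embed_graph _ G0 n.
  by rewrite card_extremal; case: posnP => _; lia.
apply: leq_trans (ge _) _; rewrite -ncopies_complete.
apply: leq_bigmax_cond; rewrite is_free_packing; apply: free => //.
by apply: extremal_free; rewrite /q; lia.
Qed.
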